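(* For integers $j,k\ge2$, \[ \int_0^1 f_j(x)f_k(x)\,dx=\frac{1}{2\pi jk}\int_{-\infty}^{\infty}\bigl(j^{\frac12-it}-1\bigr)\bigl(k^{\frac12+it}-1\bigr)\frac{\bigl|\zeta(\tfrac12+it)\bigr|^2}{\tfrac14+t^2}\,dt . \]
   Context: For each integer $k\ge2$, $f_k:(0,1]\to\mathbb{R}$ is defined by $f_k(x):=\frac{1}{k}\bigl[\frac{1}{x}\bigr]-\bigl[\frac{1}{kx}\bigr]$, where $[t]$ is the integer part of $t$. $\zeta$ is the Riemann zeta function. *)

(* Defs.v *)
From HB Require Import structures.
From mathcomp Require Import all_boot all_order all_algebra.
From mathcomp Require Import complex.
From mathcomp Require Import all_classical all_reals all_analysis.

Set Implicit Arguments.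
Unset Strict Implicit.
Unset Printing Implicit Defensive.

Import Order.TTheory GRing.Theory Num.Theory.
Import numFieldNormedType.Exports.

Local Open Scope classical_set_scope.
Local Open Scope complex_scope.
Local Open Scope ring_scope.

Definition expC (R : realType) (z : R[i]) : R[i] :=
  (expR (complex.Re z))%:C * (cos (complex.Im z) +i* sin (complex.Im z)).

(* The principal power [a ^ s = exp (s ln a)]; meaningful for [0 < a]. *)
Definition cpow (R : realType) (a : R) (s : R[i]) : R[i] :=
  expC (s * (ln a)%:C).

(* [R[i]^o] carries the topology of the modulus; [R[i]] itself has none. *)
Definition analytic_at (R : realType) (g : R[i] -> R[i]) (s0 : R[i]) : Prop :=
  exists (a : nat -> R[i]) (r : R), 0 < r /\
    forall s : R[i], `|s - s0| < r%:C ->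
      [series a n * (s - s0) ^+ n]_n @ \oo --> (g s : R[i]^o).

(* [zeta] is the analytic continuation to C \ {1} of the Dirichlet series
   [\sum_(n >= 1) n^-s], Re s > 1.  By the identity theorem this determines
   [zeta] away from the pole 1, where its value is left unspecified. *)
Definition is_riemann_zeta (R : realType) (zeta : R[i] -> R[i]) : Prop :=
  (forall s : R[i], 1 < complex.Re s ->
     [series cpow n.+1%:R (- s)]_n @ \oo --> (zeta s : R[i]^o)) /\
  (forall s : R[i], s != 1 -> analytic_at zeta s).

(* Only the values on ]0, 1] are relevant. *)
Definition fract_diff (R : realType) (k : nat) (x : R) : R :=
  k%:R^-1 * (Num.floor x^-1)%:~R - (Num.floor (k%:R * x)^-1)%:~R.

Definition Cintegrable d (T : measurableType d) (R : realType)
    (mu : {measure set T -> \bar R}) (D : set T) (g : T -> R[i]) : Prop :=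
  mu.-integrable D (fun x => (complex.Re (g x))%:E) /\
  mu.-integrable D (fun x => (complex.Im (g x))%:E).

Definition Cintegral d (T : measurableType d) (R : realType)
    (mu : {measure set T -> \bar R}) (D : set T) (g : T -> R[i]) : R[i] :=
  (\int[mu]_(x in D) complex.Re (g x)) +i* (\int[mu]_(x in D) complex.Im (g x)).

Definition zeta_integrand (R : realType) (zeta : R[i] -> R[i]) (j k : nat)
    (t : R) : R[i] :=
  (cpow j%:R (2^-1 -i* t) - 1) * (cpow k%:R (2^-1 +i* t) - 1)
  * (`|zeta (2^-1 +i* t)| ^+ 2 / (4^-1 + t ^+ 2)%:C).

(* Main.v *)
(** Put [x = exp (-u)] and let [L_b(s)] be the integral of [b(u) exp(-su)] over
    the real line.  Since [floor(exp u)]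
    counts the [n >= 1] with [ln n <= u], [zeta(s) = s L_b(s)] holds for [Re s > 1]
    with [b(u) = floor(exp u)]; subtracting the
    integral of [exp u] over [u >= 0] and continuing analytically along horizontal
    lines yields [L_b(s) = - zeta(s) / s] with [b(u)] the fractional part of
    [exp u], for [0 < Re s < 1].  Since
    [f_k(exp (-u)) = b(u - ln k) - b(u) / k], the function
    [f_k(exp (-u)) exp(-u/2)] has Fourier transform
    [(1/k - k^-s) zeta(s) / s] at [s = 1/2 + it], and the identity is Parseval's
    formula for [f_j] and [f_k].  Parseval's formula is obtained by inserting the
    weight [exp(-e|t|)], whose transform is the Poisson kernel, and letting [e]
    tend to [0]. *)
Require Import Defs.
From HB Require Import structures.
From mathcomp Require Import all_boot all_order all_algebra.
From mathcomp Require Import complex.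
From mathcomp Require Import all_classical all_reals all_analysis.
From mathcomp Require Import measurable_realfun.
From mathcomp Require Import ring lra.

Set Implicit Arguments.
Unset Strict Implicit.
Unset Printing Implicit Defensive.

Import Order.TTheory GRing.Theory Num.Theory.
Import numFieldNormedType.Exports.

Local Open Scope classical_set_scope.
Local Open Scope complex_scope.
Local Open Scope ring_scope.

(** Parseval's formula is needed only for real functions that are bounded, integrable and continuous
    off a countable set; for these the Poisson averages converge almost everywhere. Removing the
    weight requires an integrable majorant of the product of two transforms. It comes from the
    diagonal case, where the integrand is non-negative and monotone convergence yields
    square-integrability of each transform. The transform of the fractional part over the whole line
    converges only for 0 < Re s < 1, away from the half-plane of the Dirichlet series. So the
    continuation is carried out for the part over u >= 0, which converges for Re s > 0, and the part
    over u < 0 is added afterwards. The continuation stays real: for fixed t different from 0 the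
    line misses the pole, and real and imaginary parts are power series in one real variable. The
    value t = 0 is lost, which costs a single point of the final integral. The substitution x =
    exp(-u) needs no Jacobian: both integrands are functions of one integer, whose distribution is
    the same on both sides. *)

Local Notation lebR := (@lebesgue_measure _).
Local Notation integ f := (lebR.-integrable [set: _] (EFin \o f)).
Local Notation mfun f := (measurable_fun [set: _] f).
Local Notation "\intR f" := (Rintegral lebR [set: _] f) (at level 36, f at level 36).

(** * Integration on the real line *)

Section real_integrals.
Context {R : realType}.
Implicit Types f g : R -> R.

Lemma integ_mfun f : integ f -> mfun f.
Proof. by move=> /integrableP[/measurable_EFinP]. Qed.

Lemma integ_le f g : mfun f -> (forall x, `|f x| <= g x) -> integ g -> integ f.
Proof.
move=> mf fg; apply: le_integrable => //; first exact/measurable_EFinP.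
by move=> x _ /=; rewrite lee_fin (le_trans (fg x))// ler_norm.
Qed.

Lemma integ_scale k f : integ f -> integ (fun x => k * f x).
Proof. by move=> /(integrableZl measurableT k); exact: eq_integrable. Qed.

Lemma integD f g : integ f -> integ g -> integ (fun x => f x + g x).
Proof.
by move=> If Ig; have := integrableD measurableT If Ig; exact: eq_integrable.
Qed.

Lemma integB f g : integ f -> integ g -> integ (fun x => f x - g x).
Proof.
by move=> If Ig; have := integrableB measurableT If Ig; exact: eq_integrable.
Qed.

Lemma integ_bounded (b f : R -> R) (M : R) : mfun b -> (forall x, `|b x| <= M) -> integ f ->
  integ (fun x => b x * f x).
Proof.
move=> mb bM If; apply: (@integ_le _ (fun x => M * `|f x|)).
- by apply: measurable_funM => //; exact: integ_mfun.
- by move=> x; rewrite normrM ler_wpM2r.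
- by apply: integ_scale; exact: integrable_norm.
Qed.

Lemma ae_imp (P Q : R -> Prop) : (forall x, P x -> Q x) ->
  {ae lebR, forall x, P x} -> {ae lebR, forall x, Q x}.
Proof. by move=> PQ; apply: negligibleS => x /= + /PQ; apply. Qed.

Lemma intR_dominated (f_ : nat -> R -> R) f g :
  (forall n, mfun (f_ n)) -> mfun f ->
  {ae lebR, forall x, f_ ^~ x @ \oo --> f x} -> integ g ->
  (forall n x, `|f_ n x| <= g x) ->
  integ f /\ (fun n => \intR (f_ n)) @ \oo --> \intR f.
Proof.
move=> mf_ mf ff ig fg.
have [||||If _ C] := @dominated_convergence _ _ _ lebR setT measurableT
  (fun n => EFin \o f_ n) (EFin \o f) (EFin \o g) _ _ _ ig.
- by move=> n; apply/measurable_EFinP; exact: mf_.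
- exact/measurable_EFinP.
- apply: ae_imp ff => x fx _ /=.
  by apply: cvg_EFin => //; apply: nearW.
- by apply: aeW => x n _ /=; rewrite lee_fin.
split=> //; rewrite /Rintegral; apply: fine_cvg.
by rewrite fineK//; exact: integrable_fin_num.
Qed.

Lemma intR_ae_eq f g : mfun f -> mfun g ->
  {ae lebR, forall x, f x = g x} -> \intR f = \intR g.
Proof.
move=> mf mg fg; congr fine; apply: ae_eq_integral => //.
- exact/measurable_EFinP.
- exact/measurable_EFinP.
- by apply: ae_imp fg => x /= ->.
Qed.

Lemma ae_notin_countable (A : set R) (P : R -> Prop) :
  countable A -> (forall x, ~ A x -> P x) -> {ae lebR, forall x, P x}.
Proof.
move=> cA AP; exists A; split.
- exact: countable_measurable.
- exact: countable_lebesgue_measure0.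
- by move=> x /= NPx; apply: contrapT => /AP.
Qed.

Lemma measurable_affine (a b : R) : mfun (fun x : R => a * x + b).
Proof.
by apply: measurable_funD => //; apply: measurable_funM.
Qed.

Let affine_pushforward (a b : R)
    (mphi : @measurable_fun _ _ (measurableTypeR R) (measurableTypeR R) setT
      (fun x => a * x + b)) : {measure set (measurableTypeR R) -> \bar R} :=
  mscale (NngNum (normr_ge0 a))
    (measure_function_pushforward__canonical__measure_function_Measure lebR mphi).

(** Lebesgue measure is determined by its values on intervals open on the left and closed on the
    right. For negative [a] the preimage of such an interval is closed on the left instead, hence
    the two cases. *)
Let lebesgue_affine (a b : R) mphi : a != 0 -> forall A, measurable A ->
  lebR A = @affine_pushforward a b mphi A.
Proof.
move=> a0; apply: lebesgue_measure_unique => _ [[c d] _ <-] /=.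
rewrite /affine_pushforward /mscale/= /pushforward.
set phi := (fun x : g_sigma_algebraType _ => _).
have [a_gt0|a_lt0|a_eq0] := ltrgt0P a.
- rewrite (_ : phi @^-1` _ = `](c - b) / a, (d - b) / a]%classic).
    rewrite !lebesgue_measure_itv/= !lte_fin ltr_pM2r ?invr_gt0// ltrD2r.
    case: ifPn => _; last by rewrite mule0.
    by rewrite -!EFinB -EFinM; congr EFin; field.
  apply/seteqP; split=> x /=; rewrite !in_itv/= /phi.
    by rewrite ltr_pdivrMr// ler_pdivlMr// ltrBlDr lerBrDr (mulrC x).
  by rewrite ltr_pdivrMr// ler_pdivlMr// ltrBlDr lerBrDr (mulrC x).
- rewrite (_ : phi @^-1` _ = `[(d - b) / a, (c - b) / a[%classic).
    rewrite !lebesgue_measure_itv/= !lte_fin ltr_nM2r ?invr_lt0// ltrD2r.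
    case: ifPn => _; last by rewrite mule0.
    by rewrite -!EFinB -EFinM; congr EFin; field; rewrite lt_eqF.
  apply/seteqP; split=> x /=; rewrite !in_itv/= /phi.
    by rewrite ler_ndivrMr// ltr_ndivlMr// lerBrDr ltrBlDr (mulrC x) andbC.
  by rewrite ler_ndivrMr// ltr_ndivlMr// lerBrDr ltrBlDr (mulrC x) andbC.
- by rewrite a_eq0 eqxx in a0.
Qed.

Lemma integral_affine (a b : R) (f : R -> \bar R) : a != 0 -> mfun f ->
  (forall x, 0 <= f x)%E ->
  (\int[lebR]_x f x = `|a|%:E * \int[lebR]_x f (a * x + b)%R)%E.
Proof.
move=> a0 mf f0.
have mphi : @measurable_fun _ _ (measurableTypeR R) (measurableTypeR R) setT
  (fun x => a * x + b) by exact: measurable_affine.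
rewrite (@eq_measure_integral _ _ _ _ (affine_pushforward mphi)); last first.
  by move=> A mA _; exact: lebesgue_affine.
by rewrite ge0_integral_mscale//= ge0_integral_pushforward.
Qed.

Lemma integ_affine (a b : R) f : a != 0 -> integ f ->
  integ (fun x => f (a * x + b)).
Proof.
move=> a0 /integrableP[mf fy]; apply/integrableP; split.
  by exact: (measurableT_comp mf (measurable_affine a b)).
move: fy; rewrite (@integral_affine a b (fun x => `|(f x)%:E|)%E)//; last first.
  exact: measurableT_comp.
rewrite -ge0_fin_numE; last by rewrite mule_ge0// integral_ge0.
rewrite -ge0_fin_numE; last by rewrite integral_ge0.
(* The factor [|a|] is invertible, so finiteness passes from the product to the integral. *)
move=> h; rewrite -[X in X \is a fin_num]mul1e -(@mulVf _ `|a|) ?normr_eq0//.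
by rewrite EFinM -muleA fin_numM.
Qed.

Lemma intR_affine (a b : R) f : a != 0 -> integ f ->
  \intR f = `|a| * \intR (fun x => f (a * x + b)).
Proof.
move=> a0 If; have Inf : integ (fun x => `|f x|) by exact: integrable_norm.
have Ifn : integ (fun x => f x + `|f x|) by exact: integD.
have E g : integ g -> (forall x, 0 <= g x) ->
    \intR g = `|a| * \intR (fun x => g (a * x + b)).
  move=> Ig g0.
  rewrite /Rintegral (integral_affine b a0)//; last exact: measurable_int Ig.
  by rewrite fineM//; apply: integrable_fin_num => //; exact: integ_affine.
(* [integral_affine] concerns non-negative functions; [f] is a difference of two integrable ones. *)
rewrite (_ : f = (fun x => (f x + `|f x|) - `|f x|)); last first.
  by apply/funext => x; rewrite addrK.
have If0 x : 0 <= f x + `|f x|.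
  by have := ler_norm (- f x); rewrite normrN; lra.
rewrite (RintegralB measurableT Ifn Inf) (E _ Ifn If0).
rewrite (E _ Inf (fun=> normr_ge0 _)) -mulrBr; congr (_ * _).
rewrite -(RintegralB measurableT (integ_affine b a0 Ifn)) //.
exact: (integ_affine b a0 Inf).
Qed.

End real_integrals.

(** * Integrals depending on a parameter and Fubini's theorem for bounded kernels *)

Section fubini_real.
Context {R : realType}.
Implicit Types (a b : R -> R) (M : R).

Lemma measurable_section1 (K : R * R -> R) t : mfun K -> mfun (fun u => K (t, u)).
Proof. by move=> mK; apply: measurableT_comp => //; exact: pair1_measurable. Qed.

Lemma measurable_section2 (K : R * R -> R) u : mfun K -> mfun (fun t => K (t, u)).
Proof. by move=> mK; apply: measurableT_comp => //; exact: pair2_measurable. Qed.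

Lemma ge0_measurable_param (K : R * R -> R) : mfun K -> (forall x, 0 <= K x) ->
  mfun (fun t => \intR (fun u => K (t, u))).
Proof.
move=> mK K0; apply: measurableT_comp; first exact: fine_measurable.
apply: (@measurable_fun_fubini_tonelli_F _ _ (measurableTypeR R) (measurableTypeR R)
  R lebR (EFin \o K)) => //=.
exact/measurable_EFinP.
Qed.

Lemma measurable_param b (K : R * R -> R) M : integ b -> mfun K ->
  (forall x, `|K x| <= M) -> mfun (fun t => \intR (fun u => b u * K (t, u))).
Proof.
move=> Ib mK KM.
pose G (x : R * R) := b x.2 * K x.
have mG : mfun G.
  apply: measurable_funM => //.
  exact: (measurableT_comp (integ_mfun Ib) measurable_snd).
have mnG : mfun (fun x => `|G x|) by exact: measurableT_comp.
have IG t : integ (fun u => G (t, u)).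
  rewrite /G/=; under eq_fun do rewrite mulrC.
  by apply: integ_bounded Ib; [exact: measurable_section1|move=> u; exact: KM].
(* Tonelli's theorem gives measurability in the parameter for non-negative integrands, hence this
   difference. *)
rewrite (_ : (fun t => _) = (fun t => \intR (fun u => G (t, u) + `|G (t, u)|)
    - \intR (fun u => `|G (t, u)|))); last first.
  apply/funext => t; have InG := integrable_norm (IG t).
  by rewrite (RintegralD measurableT (IG t) InG) addrK.
apply: measurable_funB.
  apply: (@ge0_measurable_param (fun x => G x + `|G x|)).
    exact: measurable_funD.
  by move=> x; have := ler_norm (- G x); rewrite normrN; lra.
exact: (@ge0_measurable_param (fun x => `|G x|)).
Qed.

Lemma param_bound b (K : R * R -> R) M t : integ b -> mfun K ->
  (forall x, `|K x| <= M) ->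
  `|\intR (fun u => b u * K (t, u))| <= M * \intR (fun u => `|b u|).
Proof.
move=> Ib mK KM.
have IG : integ (fun u => b u * K (t, u)).
  under eq_fun do rewrite mulrC.
  by apply: integ_bounded Ib; [exact: measurable_section1|move=> u; exact: KM].
have Inb : integ (fun u => `|b u|) by exact: integrable_norm.
apply: (le_trans (le_normr_Rintegral measurableT IG)).
rewrite -(RintegralZl _ measurableT Inb); apply: le_Rintegral => //.
- exact: (integrable_norm IG).
- exact: (integ_scale M Inb).
- by move=> u _; rewrite normrM mulrC ler_wpM2r.
Qed.

(** Since [K] is bounded, the integrand on the plane is dominated by the tensor product
    [M * |a t| * |b u|], so Fubini's theorem applies. *)
Lemma intR_swap a b (K : R * R -> R) M : integ a -> integ b -> mfun K ->
  (forall x, `|K x| <= M) ->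
  \intR (fun t => a t * \intR (fun u => b u * K (t, u))) =
  \intR (fun u => b u * \intR (fun t => a t * K (t, u))).
Proof.
move=> Ia Ib mK KM.
pose F (x : R * R) := a x.1 * b x.2 * K x.
have mF : mfun F.
  apply: measurable_funM => //; apply: measurable_funM.
    exact: (measurableT_comp (integ_mfun Ia) measurable_fst).
  exact: (measurableT_comp (integ_mfun Ib) measurable_snd).
have IbK t : integ (fun u => b u * K (t, u)).
  under eq_fun do rewrite mulrC.
  by apply: integ_bounded Ib; [exact: measurable_section1|move=> u; exact: KM].
have IaK u : integ (fun t => a t * K (t, u)).
  under eq_fun do rewrite mulrC.
  by apply: integ_bounded Ia; [exact: measurable_section2|move=> t; exact: KM].
have mFt t : mfun (fun u => `|F (t, u)|).
  apply: measurableT_comp => //; exact: (measurable_section1 t mF).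
have IF : (@lebesgue_measure R \x @lebesgue_measure R)%E.-integrable setT (EFin \o F).
  apply/integrable12ltyP; first exact/measurable_EFinP.
  pose C := M * \intR (fun u => `|b u|).
  have IaC : integ (fun t => C * `|a t|) by exact/integ_scale/integrable_norm.
  have : (\int[@lebesgue_measure R]_t (C * `|a t|)%:E < +oo)%E.
    by move: (integrable_lty measurableT IaC).
  apply: le_lt_trans; apply: ge0_le_integral => //.
  - by move=> t _; exact: integral_ge0.
  - apply: (@measurable_fun_fubini_tonelli_F _ _ (measurableTypeR R)
      (measurableTypeR R) R lebR (fun x => `|(EFin \o F) x|)%E) => //.
    by apply: measurableT_comp => //; exact/measurable_EFinP.
  - exact: (measurable_int _ IaC).
  - move=> t _ /=.
    have Inb : integ (fun u => `|b u|) by exact: integrable_norm.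
    have -> : C * `|a t| = \intR (fun u => M * `|a t| * `|b u|).
      by rewrite (RintegralZl _ measurableT Inb) /C; ring.
    rewrite /Rintegral fineK; last first.
      apply: integrable_fin_num => //; exact: (integ_scale (M * `|a t|) Inb).
    apply: ge0_le_integral => //.
    + by apply/measurable_EFinP; exact: mFt.
    + exact: (measurable_int _ (integ_scale (M * `|a t|) Inb)).
    + move=> u _; rewrite lee_fin /F /= !normrM.
      by rewrite mulrC -mulrA ler_wpM2r ?mulr_ge0 ?KM.
have := Fubini IF; rewrite /Rintegral => E; congr fine.
transitivity (\int[@lebesgue_measure R]_t \int[@lebesgue_measure R]_u (EFin \o F) (t, u))%E.
  apply: eq_integral => t _; rewrite EFinM fineK; last first.
    exact: (integrable_fin_num measurableT (IbK t)).
  rewrite -(integralZl measurableT (IbK t)); apply: eq_integral => u _ /=.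
  by rewrite -EFinM /F/= mulrA.
rewrite E; apply: eq_integral => u _; rewrite EFinM fineK; last first.
  exact: (integrable_fin_num measurableT (IaK u)).
rewrite -(integralZl measurableT (IaK u)); apply: eq_integral => t _ /=.
by rewrite -EFinM /F/= mulrCA mulrA.
Qed.

End fubini_real.

(** * Exponential integrals on a half-line *)

Section exponential_integrals.
Context {R : realType}.
Implicit Types (f F : R -> R) (s t w : R).

(** Half-line integrals are written as integrals over the whole line with this factor. The value 1
    at 0 makes the sum of the translates by [ln n] equal to the integer part of [expR u] at the
    jumps too. *)
Definition heaviside (u : R) : R := ((0 <= u)%R)%:R.

Lemma heavisideE f : (fun u => heaviside u * f u) = f \_ `[0, +oo[.
Proof.
apply/funext => u; rewrite /heaviside patchE mem_setE in_itv/= andbT.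
by case: (0 <= u); rewrite ?mul1r ?mul0r.
Qed.

Lemma heaviside_ge0 u : 0 <= heaviside u. Proof. by []. Qed.

Lemma measurable_heaviside : mfun heaviside.
Proof.
apply: nondecreasing_measurable => // x y xy; rewrite /heaviside ler_nat.
by case: (leP 0 x) => // x0; rewrite (le_trans x0 xy).
Qed.

Lemma continuous_expRN s : continuous (fun u => expR (- s * u)).
Proof.
move=> u; apply: (@continuous_comp _ _ _ (fun u => - s * u) expR).
  exact: mulrl_continuous.
exact: continuous_expR.
Qed.

Lemma cvg_expRN s : 0 < s -> expR (- s * u) @[u --> +oo] --> (0 : R).
Proof.
move=> s0; under eq_fun do rewrite mulNr.
apply: (@cvg_comp _ _ _ (fun u => s * u) (fun x => expR (- x)) _ +oo%R).
  exact: gt0_cvgMry.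
exact: cvgr_expR.
Qed.

Lemma ge0_FTC_halfline f F : (forall u, 0 <= u -> 0 <= f u) -> continuous f ->
  (forall u : R, is_derive u 1 F (f u)) -> F u @[u --> +oo] --> (0 : R) ->
  integ (fun u => heaviside u * f u) /\ \intR (fun u => heaviside u * f u) = - F 0.
Proof.
move=> f0 cf dF F0.
have mf : mfun f by exact: continuous_measurable_fun.
have If : (\int[lebR]_(u in `[0%R, +oo[) (f u)%:E = (- F 0)%:E)%E.
  rewrite (@ge0_continuous_FTC2y _ _ F _ 0)//=.
  - by rewrite -EFinD add0r.
  - exact: continuous_subspaceT.
  - apply: cvg_at_right_filter.
    by apply/differentiable_continuous/derivable1_diffP; case: (dF 0).
  - by move=> u _; rewrite derive1E; case: (dF u).
have IE : lebR.-integrable `[0, +oo[ (EFin \o f).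
  apply/integrableP; split; first exact/measurable_EFinP/measurable_funTS.
  rewrite [ltLHS](_ : _ = (- F 0)%:E) ?ltry// -If; apply: eq_integral => u.
  by rewrite inE/= in_itv/= andbT => u0; rewrite ger0_norm ?f0.
rewrite heavisideE; split.
  have mI : measurable (`[0, +oo[%classic : set (measurableTypeR R)) by [].
  move: IE => /(@integrable_mkcond _ _ _ (@lebesgue_measure R) _ (EFin \o f) mI).
  by rewrite restrict_EFin.
by rewrite -Rintegral_mkcond /Rintegral If.
Qed.

(** [ge0_FTC_halfline] requires a non-negative integrand. The exponential [g] dominates [|f|], so
    [f + g] and [g] are both covered, and their difference gives [f]. *)
Lemma exp_dominated_FTC f F (C s : R) : 0 < s -> continuous f ->
  (forall u : R, is_derive u 1 F (f u)) ->
  (forall u, `|f u| <= C * expR (- s * u)) ->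
  (forall u, `|F u| <= C * expR (- s * u)) ->
  integ (fun u => heaviside u * f u) /\ \intR (fun u => heaviside u * f u) = - F 0.
Proof.
move=> s0 cf dF fC FC.
pose g u := C * expR (- s * u); pose G u := - (C / s) * expR (- s * u).
have C0 : 0 <= C.
  by have := le_trans (normr_ge0 _) (fC 0); rewrite mulr0 expR0 mulr1.
have cg : continuous g.
  by move=> u; apply: cvgM; [exact: cvg_cst|exact: continuous_expRN].
have dG (u : R) : is_derive u 1 G (g u).
  rewrite /G /g; apply: is_derive_eq; rewrite /GRing.scale/=.
  by field; rewrite gt_eqF.
have G0 : G u @[u --> +oo] --> (0 : R).
  by rewrite -(mulr0 (- (C / s))); apply: cvgMl_tmp; exact: cvg_expRN.
have F0 : F u @[u --> +oo] --> (0 : R).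
  apply/cvgr0Pnorm_lt => e e0.
  have : g u @[u --> +oo] --> (0 : R).
    by rewrite -(mulr0 C); apply: cvgMl_tmp; exact: cvg_expRN.
  move=> /cvgr0Pnorm_lt/(_ e e0); apply: filterS => u; apply: le_lt_trans.
  by rewrite (le_trans (FC u))// ler_norm.
have [Ig Eg] : integ (fun u => heaviside u * g u) /\ \intR (fun u => heaviside u * g u) = - G 0.
  by apply: ge0_FTC_halfline => // u _; rewrite mulr_ge0 ?expR_ge0.
have [Ih Eh] : integ (fun u => heaviside u * (f u + g u)) /\
    \intR (fun u => heaviside u * (f u + g u)) = - (F 0 + G 0).
  apply: (@ge0_FTC_halfline (fun u => f u + g u) (fun u => F u + G u)).
  - move=> u _; have := fC u; rewrite -/(g u) => /(le_trans (ler_norm _)).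
    by have := fC u; rewrite -/(g u) ler_norml; lra.
  - by move=> u; apply: cvgD; [exact: cf|exact: cg].
  - by rewrite -(addr0 0); apply: cvgD.
have E : (fun u => heaviside u * f u) = (fun u => heaviside u * (f u + g u) - heaviside u * g u).
  by apply/funext => u; ring.
rewrite E; split; first exact: integB.
by rewrite (RintegralB measurableT Ih Ig) Eh Eg; ring.
Qed.

Lemma sqr_add_gt0 s t : 0 < s -> 0 < s ^+ 2 + t ^+ 2.
Proof. by move=> s0; rewrite ltr_pwDl ?exprn_gt0 ?sqr_ge0. Qed.

Let osc s t (a b u : R) := expR (- s * u) * (a * cos (t * u) + b * sin (t * u)).

Let continuous_osc s t a b : continuous (osc s t a b).
Proof.
rewrite /osc => u; apply: cvgM; first exact: continuous_expRN.
apply: cvgD; apply: cvgM; try exact: cvg_cst.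
  apply: (@continuous_comp _ _ _ (fun u => t * u) cos).
    exact: mulrl_continuous.
  exact: continuous_cos.
apply: (@continuous_comp _ _ _ (fun u => t * u) sin).
  exact: mulrl_continuous.
exact: continuous_sin.
Qed.

Let osc_bound s t a b u : `|osc s t a b u| <= (`|a| + `|b|) * expR (- s * u).
Proof.
rewrite /osc normrM ger0_norm ?expR_ge0// mulrC ler_wpM2r ?expR_ge0//.
rewrite (le_trans (ler_normD _ _))// !normrM lerD//.
  by rewrite ler_piMr// ler_norml cos_le1 cos_geN1.
by rewrite ler_piMr// ler_norml sin_le1 sin_geN1.
Qed.

Let int_osc s t a b : 0 < s ->
  integ (fun u => heaviside u * osc s t a b u) /\
  \intR (fun u => heaviside u * osc s t a b u) = (a * s + b * t) / (s ^+ 2 + t ^+ 2).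
Proof.
move=> s0; have d0 := sqr_add_gt0 t s0.
set D := s ^+ 2 + t ^+ 2 in d0 *.
(* A primitive of [osc s t a b] is sought in the same family: [a'] and [b'] solve
   [- s * a' + t * b' = a] and [- t * a' - s * b' = b], a system of determinant [D]. *)
pose a' := - (a * s + b * t) / D; pose b' := (a * t - b * s) / D.
pose C := Num.max (`|a| + `|b|) (`|a'| + `|b'|).
have [] := @exp_dominated_FTC (osc s t a b) (osc s t a' b') C s s0.
- exact: continuous_osc.
- move=> u; rewrite /osc; apply: is_derive_eq.
  rewrite /GRing.scale/= /a' /b' /D; field.
  by rewrite gt_eqF.
- move=> u; rewrite (le_trans (osc_bound _ _ _ _ _))// ler_wpM2r ?expR_ge0//.
  by rewrite le_max lexx.
- move=> u; rewrite (le_trans (osc_bound _ _ _ _ _))// ler_wpM2r ?expR_ge0//.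
  by rewrite le_max lexx orbT.
move=> I E; split => //; rewrite E /osc !mulr0 expR0 cos0 sin0 /a'; ring.
Qed.

Lemma integ_exp_halfline s : 0 < s -> integ (fun u => heaviside u * expR (- s * u)).
Proof.
move=> /(int_osc 0 1 0)[+ _]; rewrite /osc; congr (integ _).
by apply/funext => u; rewrite !mul0r cos0 addr0 !mulr1.
Qed.

Lemma intR_expcos s t : 0 < s ->
  \intR (fun u => heaviside u * (expR (- s * u) * cos (t * u))) = s / (s ^+ 2 + t ^+ 2).
Proof.
move=> /(int_osc t 1 0)[_]; rewrite /osc mul1r mul0r addr0 => <-.
by congr (\intR _); apply/funext => u; rewrite mul0r addr0 mul1r.
Qed.

Lemma intR_expsin s t : 0 < s ->
  \intR (fun u => heaviside u * (expR (- s * u) * sin (t * u))) = t / (s ^+ 2 + t ^+ 2).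
Proof.
move=> /(int_osc t 0 1)[_]; rewrite /osc mul1r mul0r add0r => <-.
by congr (\intR _); apply/funext => u; rewrite mul0r add0r mul1r.
Qed.

End exponential_integrals.

(** * Real-analytic functions *)

Section real_analytic.
Context {R : realType}.
Implicit Types (f g : R -> R) (x h r : R) (a b : nat -> R).

Definition ranalytic f x := exists a r, 0 < r /\
  forall h, `|h| < r -> [series a n * h ^+ n]_n @ \oo --> f (x + h).

Lemma ranalytic_cst c x : ranalytic (fun=> c) x.
Proof.
exists (fun n => if n is 0 then c else 0), 1; split=> // h _.
rewrite -cvg_shiftS; under eq_fun => n.
  rewrite /series/= big_nat_recl//= expr0 mulr1 big1 ?addr0.
    over.
  by move=> i _; rewrite mul0r.
exact: cvg_cst.
Qed.

Lemma ranalyticD f g x : ranalytic f x -> ranalytic g x ->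
  ranalytic (fun y => f y + g y) x.
Proof.
move=> [a [r [r0 ar]]] [b [q [q0 bq]]].
exists (fun n => a n + b n), (Num.min r q); split; first by rewrite lt_min r0.
move=> h; rewrite lt_min => /andP[/ar ha /bq hb].
rewrite (_ : series _ = series (fun n => a n * h ^+ n) \+ series (fun n => b n * h ^+ n)).
  exact: cvgD.
apply/funext => n; rewrite /series/= -big_split/=.
by apply: eq_bigr => i _; rewrite mulrDl.
Qed.

Lemma ranalyticZ k f x : ranalytic f x -> ranalytic (fun y => k * f y) x.
Proof.
move=> [a [r [r0 ar]]]; exists (fun n => k * a n), r; split=> // h /ar ha.
rewrite (_ : series _ = (fun N => k * series (fun n => a n * h ^+ n) N)).
  by apply: cvgM => //; exact: cvg_cst.
apply/funext => n; rewrite /series/= big_distrr/=.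
by apply: eq_bigr => i _; rewrite mulrA.
Qed.

(** Write [y = (y - x) + x]: the first part shifts the coefficients by one, the second rescales
    them. General products of series are avoided, as only polynomial factors occur later. *)
Lemma ranalyticX f x : ranalytic f x -> ranalytic (fun y => y * f y) x.
Proof.
move=> af.
have [b [r [r0 br]]] : ranalytic (fun y => (y - x) * f y) x.
  case: af => a [r [r0 ar]]; exists (fun n => if n is m.+1 then a m else 0), r.
  split=> // h /ar ha; rewrite [x + h]addrC addrK -cvg_shiftS.
  rewrite (_ : (fun n => _) = (fun N => h * series (fun n => a n * h ^+ n) N)).
    by apply: cvgM; [exact: cvg_cst|rewrite addrC].
  apply/funext => n; rewrite /series/= big_nat_recl//= mul0r add0r big_distrr/=.
  by apply: eq_bigr => i _; rewrite exprS mulrCA.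
have [c [q [q0 cq]]] : ranalytic (fun y => (y - x) * f y + x * f y) x.
  by apply: ranalyticD; [exists b, r|exact: ranalyticZ].
exists c, q; split=> // h /cq; rewrite -mulrDl subrK; exact.
Qed.

(** Convergence at [p] bounds the terms [a n * p ^+ n] by some [B]. For [h <= p / 2] the terms after
    the first are then dominated by a geometric series of sum O(h), so [|a 0|] is O(h) as well. Only
    positive [h] are assumed, because a function will be known to vanish only to the right of a
    point. *)
Lemma pseries_eq0_coef0 a r : 0 < r ->
  (forall h, 0 < h < r -> [series a n * h ^+ n]_n @ \oo --> (0 : R)) -> a 0%N = 0.
Proof.
move=> r0 ar; pose p := r / 2.
have p0 : 0 < p by rewrite divr_gt0.
have /ar ap : 0 < p < r by rewrite p0 /p; lra.
have /cvg_series_cvg_0 : cvgn (series (fun n => a n * p ^+ n)).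
  by apply/cvg_ex; exists 0.
move=> /(cvgP _)/cvg_seq_bounded [M [Mr HM]].
pose B := `|M| + 1.
have aB n : `|a n * p ^+ n| <= B.
  by apply: (HM B) => //; rewrite /B (le_lt_trans (ler_norm M))// ltrDl.
have B0 : 0 < B by rewrite ltr_wpDl.
have geo (q : R) N : 0 <= q -> q <= 2^-1 -> \sum_(0 <= m < N) q ^+ m <= 2.
  move=> q0 q2; suff : \sum_(0 <= m < N) q ^+ m <= 2 * (1 - 2^-1 ^+ N).
    move=> /le_trans; apply; have : 0 <= (2^-1 : R) ^+ N by rewrite exprn_ge0.
    lra.
  elim: N => [|N IH]; first by rewrite big_geq// expr0 subrr mulr0.
  rewrite big_nat_recr//= exprS; have : q ^+ N <= 2^-1 ^+ N by rewrite lerXn2r ?nnegrE.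
  lra.
have key h : 0 < h -> h <= p / 2 -> `|a 0%N| <= 2 * B / p * h.
  move=> h0 hp; have /ar H : 0 < h < r by rewrite h0/= (le_lt_trans hp)// /p; lra.
  have q0 : 0 <= h / p by rewrite divr_ge0// ltW.
  have q2 : h / p <= 2^-1 by rewrite ler_pdivrMr// mulrC.
  have bnd N : `|a 0%N - series (fun n => a n * h ^+ n) N.+1| <= 2 * B / p * h.
    rewrite /series/= big_nat_recl//= expr0 mulr1 opprD addrA subrr sub0r normrN.
    apply: (le_trans (ler_norm_sum _ _ _)).
    apply: (@le_trans _ _ (\sum_(0 <= i < N) B * (h / p) * (h / p) ^+ i)).
      apply: ler_sum => i _; rewrite -mulrA -exprS.
      have -> : a i.+1 * h ^+ i.+1 = a i.+1 * p ^+ i.+1 * (h / p) ^+ i.+1.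
        by rewrite -mulrA -exprMn (_ : p * (h / p) = h)// mulrC divfK ?gt_eqF.
      by rewrite normrM (ger0_norm (exprn_ge0 _ q0)) ler_wpM2r ?exprn_ge0.
    rewrite -big_distrr/= [leRHS](_ : _ = B * (h / p) * 2); last by ring.
    by rewrite ler_wpM2l ?geo// mulr_ge0// ltW.
  have L : `|a 0%N - series (fun n => a n * h ^+ n) N.+1| @[N --> \oo] --> `|a 0%N|.
    rewrite -{2}(subr0 (a 0%N)); apply: cvg_norm; apply: cvgB; first exact: cvg_cst.
    by rewrite cvg_shiftS.
  rewrite -(cvg_lim _ L)//; apply: limr_le; first by apply/cvg_ex; eexists; exact: L.
  by apply: nearW.
apply/eqP; rewrite -normr_eq0 eq_le normr_ge0 andbT leNgt; apply/negP => A0.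
(* With this [h] the bound in [key] is at most half of [|a 0|], a contradiction. *)
pose h := Num.min (p / 2) (`|a 0%N| * p / (4 * B)).
have h0 : 0 < h by rewrite lt_min !divr_gt0 ?mulr_gt0.
have := key h h0; rewrite ge_min lexx => /(_ isT).
have : h <= `|a 0%N| * p / (4 * B) by rewrite ge_min lexx orbT.
have c0 : 0 <= 2 * B / p by rewrite divr_ge0 ?mulr_ge0// ltW.
move=> /(ler_wpM2l c0).
have -> : 2 * B / p * (`|a 0%N| * p / (4 * B)) = `|a 0%N| / 2.
  by field; rewrite !gt_eqF.
lra.
Qed.

(** Once the constant term is known to vanish, dividing by [h] leaves the shifted series, which
    satisfies the same hypothesis. *)
Lemma pseries_eq0_coef a r : 0 < r ->
  (forall h, 0 < h < r -> [series a n * h ^+ n]_n @ \oo --> (0 : R)) ->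
  forall n, a n = 0.
Proof.
move=> r0 ar n; elim: n a ar => [|n IH] a ar; first exact: pseries_eq0_coef0 ar.
apply: (IH (fun n => a n.+1)) => h hr.
have a0 := pseries_eq0_coef0 r0 ar.
have /andP[h0 _] := hr.
have := ar h hr; rewrite -cvg_shiftS => H.
rewrite (_ : series _ = (fun N => h^-1 * series (fun n => a n * h ^+ n) N.+1)).
  by rewrite -(mulr0 h^-1); apply: cvgM => //; exact: cvg_cst.
apply/funext => N; rewrite /series/= big_nat_recl//= a0 mul0r add0r big_distrr/=.
apply: eq_bigr => i _; rewrite exprS; field; exact: lt0r_neq0.
Qed.

Lemma ranalytic_vanish f x : ranalytic f x -> (forall y, x < y -> f y = 0) ->
  exists2 r, 0 < r & forall y, x - r < y -> f y = 0.
Proof.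
move=> [a [r [r0 ar]]] fx; exists r => // y xy.
have [/fx//|yx] := ltP x y.
have a0 : forall n, a n = 0.
  apply: (pseries_eq0_coef r0) => h /andP[h0 hr].
  by have := ar h; rewrite ger0_norm 1?ltW// fx ?ltrDl//; exact.
have := ar (y - x); rewrite (_ : x + (y - x) = y); last by ring.
move=> H.
have : `|y - x| < r by rewrite ler0_norm; lra.
move=> /H; rewrite (_ : series _ = fun=> 0); last first.
  by apply/funext => n; rewrite /series/= big1// => i _; rewrite a0 mul0r.
by move=> /(cvg_lim (@Rhausdorff R)) <-; rewrite lim_cst.
Qed.

(** Identity theorem, propagated leftwards: if the infimum of the positive points beyond which [f]
    vanishes were positive, [ranalytic_vanish] would move it further left. *)
Lemma ranalytic_eq0 f c : (forall x, 0 < x -> ranalytic f x) ->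
  (forall x, c < x -> f x = 0) -> forall x, 0 < x -> f x = 0.
Proof.
move=> af fc.
pose A := [set y | 0 < y /\ forall z, y < z -> f z = 0].
have A0 : A (Num.max c 1).
  split; first by rewrite lt_max ltr01 orbT.
  by move=> z; rewrite gt_max => /andP[/fc].
have Ainf : has_inf A by split; [exists (Num.max c 1)|exists 0 => y [/ltW]].
have fm z : inf A < z -> f z = 0.
  by move=> /(inf_lt Ainf.1)[y [_ H] /H].
move=> x x0; have [/fm//|xm] := ltP (inf A) x.
have m0 : 0 < inf A by exact: lt_le_trans xm.
have [r r0 fr] := ranalytic_vanish (af _ m0) fm.
(* [inf A - r] is where vanishing is now known to begin; the maximum with [inf A / 2] keeps [y]
   positive. *)
pose y := Num.max (inf A - r) (inf A / 2).
have ym : y < inf A by rewrite gt_max; apply/andP; split; lra.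
have Ay : A y.
  split; first by rewrite lt_max; apply/orP; right; lra.
  by move=> z; rewrite gt_max => /andP[/fr].
by have := ge_inf Ainf.2 Ay; rewrite leNgt ym.
Qed.

Lemma series_exp_coeff_le (y : R) N : 0 <= y -> series (exp_coeff y) N <= expR y.
Proof.
move=> y0; apply: nondecreasing_cvgn_le; last exact: is_cvg_series_exp_coeff.
apply/nondecreasing_seqP => n; rewrite /series/= big_nat_recr//= lerDl.
exact: exp_coeff_ge0.
Qed.

Lemma norm_series_exp_coeff_le (y : R) N : `|series (exp_coeff y) N| <= expR `|y|.
Proof.
rewrite (le_trans _ (series_exp_coeff_le N (normr_ge0 y)))//.
rewrite (le_trans (ler_norm_sum _ _ _))// ler_sum// => i _.
by rewrite /exp_coeff/= normrM normrX normfV (ger0_norm (ler0n _ _)).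
Qed.

Lemma norm_exp_coeff_le (y : R) n : `|exp_coeff y n| <= expR `|y|.
Proof.
rewrite (le_trans _ (series_exp_coeff_le n.+1 (normr_ge0 y)))//.
rewrite /series/= big_nat_recr//= -[leLHS]add0r lerD//.
  by rewrite sumr_ge0// => i _; exact: exp_coeff_ge0.
by rewrite /exp_coeff/= normrM normrX normfV (ger0_norm (ler0n _ _)).
Qed.

(** Expand [expR (- h * u)] under the integral. Every partial sum is at most [expR (|h| * u)] in
    modulus for [u >= 0], and against [expR (- x * u)] this stays integrable as long as [|h| < x];
    hence the radius [x]. *)
Lemma laplace_ranalytic (b : R -> R) (M x : R) : mfun b -> (forall u, `|b u| <= M) ->
  0 < x -> ranalytic (fun s => \intR (fun u => heaviside u * (b u * expR (- s * u)))) x.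
Proof.
move=> mb bM x0.
have M0 : 0 <= M by exact: le_trans (normr_ge0 _) (bM 0).
pose T h n u := heaviside u * (b u * expR (- x * u)) * exp_coeff (- h * u) n.
have mE (s : R) : mfun (fun u : R => expR (- s * u)).
  by apply: continuous_measurable_fun; exact: continuous_expRN.
have mT h n : mfun (T h n).
  apply: measurable_funM.
    by apply: measurable_funM; [exact: measurable_heaviside|exact: measurable_funM].
  rewrite /exp_coeff/=; apply: measurable_funM => //.
  by apply: measurable_funX; apply: measurable_funM.
pose D h u := M * (heaviside u * expR (- (x - `|h|) * u)).
have ID h : `|h| < x -> integ (D h).
  by move=> hx; apply/integ_scale/integ_exp_halfline; rewrite subr_gt0.
have dom h u (c : R) : `|c| <= expR `|- h * u| ->
    `|heaviside u * (b u * expR (- x * u)) * c| <= D h u.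
  move=> cE; rewrite /D /heaviside; have [u0|_] := leP 0 u; last first.
    by rewrite !mul0r normr0 mulr0.
  rewrite !mul1r !normrM (ger0_norm (expR_ge0 _)) -mulrA; apply: ler_pM => //.
  rewrite mulNr normrN normrM (ger0_norm u0) in cE.
  by rewrite opprB mulrBl expRD mulrC mulNr ler_wpM2r// expR_ge0.
have IT h n : `|h| < x -> integ (T h n).
  move=> hx; apply: (integ_le (mT h n) _ (ID h hx)) => u.
  exact/dom/norm_exp_coeff_le.
pose A n u := heaviside u * (b u * expR (- x * u)) * ((- u) ^+ n / n`!%:R).
have TA h n : T h n = (fun u => h ^+ n * A n u).
  apply/funext => u; rewrite /T /A.
  have -> : - h * u = h * - u by rewrite mulNr mulrN.
  by rewrite /exp_coeff/= exprMn [RHS]mulrCA !mulrA.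
have IA n : integ (A n).
  (* Integrability of the moment is read off from the term of index [n] at the particular increment
     [x / 2]. *)
  have -> : A n = (fun u => (x / 2) ^- n * T (x / 2) n u).
    apply/funext => u; rewrite TA mulrA mulVf ?mul1r// expf_neq0// gt_eqF//.
    by rewrite divr_gt0.
  by apply/integ_scale/IT; rewrite ger0_norm; lra.
exists (fun n => \intR (A n)), x; split=> // h hx.
have S N : integ (fun u => \sum_(0 <= n < N) T h n u) /\
    \intR (fun u => \sum_(0 <= n < N) T h n u) = \sum_(0 <= n < N) \intR (A n) * h ^+ n.
  elim: N => [|N [IN EN]].
    under eq_fun do rewrite big_geq//.
    rewrite big_geq//; split; first exact: integrable0.
    by rewrite Rintegral_cst// mul0r.
  under eq_fun do rewrite big_nat_recr//=.
  rewrite big_nat_recr//=; split; first exact: integD (IT h N hx).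
  rewrite (RintegralD measurableT IN (IT h N hx)) EN; congr (_ + _).
  by rewrite TA (RintegralZl _ measurableT (IA N)) mulrC.
have TS N u : \sum_(0 <= n < N) T h n u =
    heaviside u * (b u * expR (- x * u)) * series (exp_coeff (- h * u)) N.
  by rewrite /T /series/= big_distrr.
have [||||_ C] := @intR_dominated _ (fun N u => \sum_(0 <= n < N) T h n u)
  (fun u => heaviside u * (b u * expR (- (x + h) * u))) (D h) _ _ _ (ID h hx).
- by move=> N; exact: integ_mfun (S N).1.
- by apply: measurable_funM; [exact: measurable_heaviside|exact: measurable_funM].
- apply: aeW => u /=; under eq_fun do rewrite TS.
  have -> : heaviside u * (b u * expR (- (x + h) * u)) =
      heaviside u * (b u * expR (- x * u)) * expR (- h * u).
    by rewrite opprD mulrDl expRD; ring.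
  by apply: cvgM; [exact: cvg_cst|exact: is_cvg_series_exp_coeff].
- by move=> N u; rewrite TS; exact/dom/norm_series_exp_coeff_le.
apply: cvg_trans C; rewrite (_ : series _ = (fun N => \intR (fun u => \sum_(0 <= n < N) T h n u)))//.
by apply/funext => N; rewrite (S N).2.
Qed.

Lemma cvg_Re (u : nat -> R[i]) (l : R[i]) : u @ \oo --> (l : R[i]^o) ->
  (fun n => complex.Re (u n)) @ \oo --> complex.Re l.
Proof.
move=> ul0; have /cvgrPdist_lt ul : (u : nat -> R[i]^o) @ \oo --> (l : R[i]^o) := ul0.
apply/cvgrPdist_lt => e e0.
have := ul e%:C; rewrite ltcR => /(_ e0); apply: filterS => n.
rewrite -ltcR; apply: le_lt_trans.
by have := normc_ge_Re (l - u n); rewrite raddfB.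
Qed.

Lemma cvg_Im (u : nat -> R[i]) (l : R[i]) : u @ \oo --> (l : R[i]^o) ->
  (fun n => complex.Im (u n)) @ \oo --> complex.Im l.
Proof.
move=> ul0; have /cvgrPdist_lt ul : (u : nat -> R[i]^o) @ \oo --> (l : R[i]^o) := ul0.
apply/cvgrPdist_lt => e e0.
have := ul e%:C; rewrite ltcR => /(_ e0); apply: filterS => n.
rewrite -ltcR; apply: le_lt_trans.
rewrite -raddfB; case: (l - u n) => p q; rewrite normc_def/= lecR -[leLHS]sqrtr_sqr.
by rewrite ler_wsqrtr// lerDr sqr_ge0.
Qed.

(** Along a horizontal line the increment is real, so taking real or imaginary parts of the
    coefficients commutes with summing the series. *)
Lemma analytic_ReIm (g : R[i] -> R[i]) x t : analytic_at g (x +i* t) ->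
  ranalytic (fun y => complex.Re (g (y +i* t))) x /\
  ranalytic (fun y => complex.Im (g (y +i* t))) x.
Proof.
move=> [a [r [r0 ar]]].
have H h : `|h| < r -> [series a n * (h%:C) ^+ n]_n @ \oo --> (g ((x + h) +i* t) : R[i]^o).
  move=> hr; have E : ((x + h) +i* t) - (x +i* t) = h%:C.
    by apply/eqP; rewrite eq_complex/=; apply/andP; split; apply/eqP; ring.
  by have := ar ((x + h) +i* t); rewrite E normc_def/= expr0n addr0 sqrtr_sqr ltcR; exact.
split.
- exists (fun n => complex.Re (a n)), r; split=> // h /H/cvg_Re; apply: cvg_trans.
  rewrite (_ : series _ = (fun n => complex.Re (series (fun n => a n * (h%:C) ^+ n) n)))//.
  apply/funext => n; rewrite /series/= raddf_sum; apply: eq_bigr => i _.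
  by rewrite -rmorphXn/=; case: (a i) => p q /=; rewrite mulr0 subr0.
- exists (fun n => complex.Im (a n)), r; split=> // h /H/cvg_Im; apply: cvg_trans.
  rewrite (_ : series _ = (fun n => complex.Im (series (fun n => a n * (h%:C) ^+ n) n)))//.
  apply/funext => n; rewrite /series/= raddf_sum; apply: eq_bigr => i _.
  by rewrite -rmorphXn/=; case: (a i) => p q /=; rewrite mulr0 add0r.
Qed.

End real_analytic.

(** * Parseval's formula *)

Section plancherel.
Context {R : realType}.
Implicit Types (g F : R -> R) (e t u v w M : R).

(** For real [g] the Fourier transform is [Fcos g t - i Fsin g t]; working with the two parts keeps
    all the integration real. *)
Definition Fcos g t := \intR (fun u => g u * cos (t * u)).
Definition Fsin g t := \intR (fun u => g u * sin (t * u)).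

Lemma norm_cos_le1 (x : R) : `|cos x| <= 1.
Proof. by rewrite ler_norml cos_le1 cos_geN1. Qed.

Lemma norm_sin_le1 (x : R) : `|sin x| <= 1.
Proof. by rewrite ler_norml sin_le1 sin_geN1. Qed.

Lemma measurable_cos : mfun (@cos R).
Proof. by apply: continuous_measurable_fun; exact: continuous_cos. Qed.

Lemma measurable_sin : mfun (@sin R).
Proof. by apply: continuous_measurable_fun; exact: continuous_sin. Qed.

Lemma measurable_prod2 : mfun (fun x : R * R => x.1 * x.2).
Proof. by apply: measurable_funM; [exact: measurable_fst|exact: measurable_snd]. Qed.

Lemma measurable_cos2 : mfun (fun x : R * R => cos (x.1 * x.2)).
Proof. exact: (measurableT_comp measurable_cos measurable_prod2). Qed.

Lemma measurable_sin2 : mfun (fun x : R * R => sin (x.1 * x.2)).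
Proof. exact: (measurableT_comp measurable_sin measurable_prod2). Qed.

Lemma integ_cosM g t : integ g -> integ (fun u => g u * cos (t * u)).
Proof.
move=> Ig; under eq_fun do rewrite mulrC; apply: integ_bounded Ig.
- exact: (@measurable_section1 _ (fun x => cos (x.1 * x.2)) t measurable_cos2).
- by move=> u; exact: norm_cos_le1.
Qed.

Lemma integ_sinM g t : integ g -> integ (fun u => g u * sin (t * u)).
Proof.
move=> Ig; under eq_fun do rewrite mulrC; apply: integ_bounded Ig.
- exact: (@measurable_section1 _ (fun x => sin (x.1 * x.2)) t measurable_sin2).
- by move=> u; exact: norm_sin_le1.
Qed.

Lemma measurable_Fcos g : integ g -> mfun (Fcos g).
Proof.
move=> Ig; apply: (@measurable_param _ g (fun x => cos (x.1 * x.2)) 1) => //.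
  exact: measurable_cos2.
by move=> x; exact: norm_cos_le1.
Qed.

Lemma measurable_Fsin g : integ g -> mfun (Fsin g).
Proof.
move=> Ig; apply: (@measurable_param _ g (fun x => sin (x.1 * x.2)) 1) => //.
  exact: measurable_sin2.
by move=> x; exact: norm_sin_le1.
Qed.

Lemma Fcos_bound g t : integ g -> `|Fcos g t| <= \intR (fun u => `|g u|).
Proof.
move=> Ig; rewrite -[leRHS]mul1r.
apply: (@param_bound _ g (fun x => cos (x.1 * x.2)) 1) => //.
  exact: measurable_cos2.
by move=> x; exact: norm_cos_le1.
Qed.

Lemma Fsin_bound g t : integ g -> `|Fsin g t| <= \intR (fun u => `|g u|).
Proof.
move=> Ig; rewrite -[leRHS]mul1r.
apply: (@param_bound _ g (fun x => sin (x.1 * x.2)) 1) => //.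
  exact: measurable_sin2.
by move=> x; exact: norm_sin_le1.
Qed.

Lemma FcosN g t : Fcos g (- t) = Fcos g t.
Proof. by rewrite /Fcos; congr (\intR _); apply/funext => u; rewrite mulNr cosN. Qed.

Lemma FsinN g t : integ g -> Fsin g (- t) = - Fsin g t.
Proof.
move=> Ig; transitivity (-1 * Fsin g t); last by rewrite mulN1r.
rewrite /Fsin -(RintegralZl _ measurableT (integ_sinM t Ig)).
by congr (\intR _); apply/funext => u; rewrite mulNr sinN mulN1r mulrN.
Qed.

(** Left without the factor 1/pi: its total mass is pi, which is the origin of pi in the final
    constant. *)
Definition poisson e w := e / (e ^+ 2 + w ^+ 2).

(** The sum of products is the double integral of [g1 u * g2 v * cos (t * (u - v))]. The weight
    makes the integral in [t] absolutely convergent, so it can be moved inside both others, where it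
    yields the kernel. *)
Lemma regularized_parseval g1 g2 e : 0 < e -> integ g1 -> integ g2 ->
  \intR (fun t => heaviside t * expR (- e * t) *
    (Fcos g1 t * Fcos g2 t + Fsin g1 t * Fsin g2 t)) =
  \intR (fun u => g1 u * \intR (fun v => g2 v * poisson e (u - v))).
Proof.
move=> e0 I1 I2; pose a t := heaviside t * expR (- e * t).
have Ia : integ a by exact: integ_exp_halfline.
pose B := \intR (fun u => `|g2 u|).
(* [K (t, u)] is the integral over [v] alone. Its expanded form shows that it is bounded and jointly
   measurable, so [t] can be exchanged with [u], then with [v]. *)
pose K (x : R * R) := cos (x.1 * x.2) * Fcos g2 x.1 + sin (x.1 * x.2) * Fsin g2 x.1.
have mK : mfun K.
  apply: measurable_funD; apply: measurable_funM.
  - exact: measurable_cos2.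
  - exact: (measurableT_comp (measurable_Fcos I2) measurable_fst).
  - exact: measurable_sin2.
  - exact: (measurableT_comp (measurable_Fsin I2) measurable_fst).
have KB x : `|K x| <= B + B.
  rewrite (le_trans (ler_normD _ _))// lerD// normrM.
    rewrite -[leRHS]mul1r ler_pM//; first exact: norm_cos_le1.
    exact: Fcos_bound.
  rewrite -[leRHS]mul1r ler_pM//; first exact: norm_sin_le1.
  exact: Fsin_bound.
have KE t u : K (t, u) = \intR (fun v => g2 v * cos (t * (u - v))).
  rewrite /K/= /Fcos /Fsin.
  rewrite -(RintegralZl _ measurableT (integ_cosM t I2)).
  rewrite -(RintegralZl _ measurableT (integ_sinM t I2)).
  rewrite -(RintegralD measurableT (integ_scale _ (integ_cosM t I2))
    (integ_scale _ (integ_sinM t I2))).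
  congr (\intR _); apply/funext => v; rewrite mulrBr cosB; ring.
transitivity (\intR (fun t => a t * \intR (fun u => g1 u * K (t, u)))).
  congr (\intR _); apply/funext => t; congr (_ * _).
  have IC := integ_cosM t I1; have IS := integ_sinM t I1.
  have Ec : Fcos g1 t = \intR (fun u => g1 u * cos (t * u)) by [].
  have Es : Fsin g1 t = \intR (fun u => g1 u * sin (t * u)) by [].
  rewrite /K/= Ec Es mulrC [X in _ + X]mulrC.
  rewrite -(RintegralZl _ measurableT IC) -(RintegralZl _ measurableT IS).
  rewrite -(RintegralD measurableT (integ_scale _ IC) (integ_scale _ IS)).
  congr (\intR _); apply/funext => u; ring.
rewrite (intR_swap Ia I1 mK KB); congr (\intR _); apply/funext => u; congr (_ * _).
under eq_Rintegral do rewrite KE.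
have mK' : mfun (fun x : R * R => cos (x.1 * (u - x.2))).
  apply: measurableT_comp; first exact: measurable_cos.
  apply: measurable_funM; first exact: measurable_fst.
  by apply: measurable_funB => //; exact: measurable_snd.
rewrite (@intR_swap _ a g2 (fun x => cos (x.1 * (u - x.2))) 1 Ia I2 mK')/=; last first.
  by move=> x; exact: norm_cos_le1.
congr (\intR _); apply/funext => v; congr (_ * _).
rewrite /poisson -(intR_expcos (u - v) e0); congr (\intR _); apply/funext => t.
by rewrite /a mulrA (mulrC t).
Qed.

(** Only [|F|] is assumed even, so that the lemma serves both the even real part and the odd
    imaginary part of a product of transforms. *)
Lemma integ_even_norm F : mfun F -> (forall t, `|F (- t)| = `|F t|) ->
  integ (fun t => heaviside t * F t) -> integ F /\
  \intR F = \intR (fun t => heaviside t * F t) + \intR (fun t => heaviside t * F (- t)).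
Proof.
move=> mF Fe Ih; have N10 : (-1 : R) != 0 by rewrite oppr_eq0 oner_eq0.
have mFN : mfun (fun t => F (- t)) by apply: measurableT_comp.
have Ih2 : integ (fun t => heaviside t * F (- t)).
  apply: (integ_le _ _ (integrable_norm Ih)).
    by apply: measurable_funM => //; exact: measurable_heaviside.
  by move=> t /=; rewrite !normrM Fe.
have Ih3 := integ_affine 0 N10 Ih2.
have E3 : (fun x => heaviside (-1 * x + 0) * F (- (-1 * x + 0))) = (fun t => heaviside (- t) * F t).
  by apply/funext => t; rewrite addr0 mulN1r opprK.
rewrite E3 in Ih3.
have IF : integ F.
  apply: (integ_le mF _ (integD (integrable_norm Ih) (integrable_norm Ih3))).
  move=> t /=; rewrite !normrM /heaviside; have [t0|t0] := leP 0 t.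
    by rewrite normr1 mul1r lerDl mulr_ge0.
  by rewrite oppr_ge0 (ltW t0) normr1 mul1r lerDr mulr_ge0.
split=> //.
rewrite [X in _ + X](intR_affine 0 N10 Ih2) E3 normrN normr1 mul1r.
rewrite -(RintegralD measurableT Ih Ih3); apply: intR_ae_eq => //.
  apply: measurable_funD; first exact: integ_mfun Ih.
  exact: integ_mfun Ih3.
(* The two half-lines both contain 0, so the decomposition holds only off that point. *)
apply: (@ae_notin_countable _ [set 0]); first exact: countable1.
move=> t t0; rewrite /heaviside; have [tp|tn] := ltP 0 t.
  by rewrite oppr_ge0 (ltW tp) leNgt tp/= mul1r mul0r addr0.
have tn' : t < 0 by rewrite lt_neqAle tn andbT; apply/eqP => /t0.
by rewrite oppr_ge0 leNgt tn' (ltW tn')/= mul0r mul1r add0r.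
Qed.

Let cauchy w := (1 + w ^+ 2)^-1 : R.

Let cauchy_gt0 w : 0 < cauchy w.
Proof. by rewrite invr_gt0 ltr_pwDl// sqr_ge0. Qed.

Let continuous_cauchy : continuous cauchy.
Proof. by move=> w; exact: (@continuous_oneDsqrV R). Qed.

Lemma integ_cauchy : integ cauchy /\ \intR cauchy = pi.
Proof.
have mc : mfun cauchy.
  by apply: continuous_measurable_fun; exact: continuous_cauchy.
have E : (\int[lebR]_x (cauchy x)%:E = pi%:E)%E.
  rewrite ge0_symfun_integralT//; last first.
    by move=> w; rewrite /= /cauchy sqrrN.
    by move=> w; exact/ltW/cauchy_gt0.
  rewrite -set_itvcy (@integral0y_oneDsqr R) -EFinM.
  by congr EFin; field.
split; last by rewrite /Rintegral E.
apply/integrableP; split; first exact/measurable_EFinP.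
rewrite [ltLHS](_ : _ = pi%:E) ?ltry// -E; apply: eq_integral => w _ /=.
by rewrite ger0_norm// ltW.
Qed.

(** After [v = e * w + u] the kernel no longer depends on [e], which is what lets dominated
    convergence act as [e] tends to 0. *)
Lemma poisson_rescale g e u : 0 < e -> integ g ->
  \intR (fun v => g v * poisson e (u - v)) =
  \intR (fun w => g (e * w + u) * cauchy w).
Proof.
move=> e0 Ig; have e0' : e != 0 by rewrite gt_eqF.
have Ip : integ (fun v => g v * poisson e (u - v)).
  under eq_fun do rewrite mulrC; apply: (@integ_bounded _ _ _ e^-1) Ig.
    rewrite /poisson; apply: measurable_funM => //.
    apply: continuous_measurable_fun => v.
    apply: cvgV; first by rewrite gt_eqF// sqr_add_gt0.
    apply: cvgD; first exact: cvg_cst.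
    apply: (@cvg_comp _ _ _ (fun x => u - x) (fun y => y ^+ 2) _ (nbhs (u - v))).
      by apply: cvgB => //; exact: cvg_cst.
    exact: exprn_continuous.
  move=> v; have d0 := sqr_add_gt0 (u - v) e0.
  rewrite /poisson ger0_norm; last by rewrite divr_ge0// ltW.
  rewrite ler_pdivrMr//.
  by rewrite mulrDr expr2 mulKf// lerDl mulr_ge0 ?sqr_ge0// invr_ge0 ltW.
rewrite (intR_affine u e0' Ip).
rewrite -(RintegralZl _ measurableT (integ_affine u e0' Ip)) gtr0_norm//.
congr (\intR _); apply/funext => w; rewrite /poisson /cauchy.
have -> : u - (e * w + u) = - (e * w) by ring.
have d0 := sqr_add_gt0 (- (e * w)) e0.
have c0 := cauchy_gt0 w; rewrite invr_gt0 in c0.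
by field; rewrite (gt_eqF d0) (gt_eqF c0).
Qed.

Let eps (n : nat) : R := n.+1%:R^-1.

Let eps_gt0 n : 0 < eps n. Proof. by rewrite invr_gt0. Qed.

Let cvg_eps : eps @ \oo --> (0 : R).
Proof. exact: cvg_harmonic. Qed.

Variables (A : set R) (countA : countable A).

(** Integrability makes the transforms exist, the bound supplies the majorant [M * cauchy], and
    continuity off [A] gives convergence of the Poisson averages. The exceptional set [A]
    accommodates the jumps of step functions. *)
Let admissible g := exists M, [/\ integ g, forall u, `|g u| <= M &
  forall u, ~ A u -> g v @[v --> u] --> g u].

(** Dominated convergence is applied twice: in [w], at each [u] outside [A], with majorant
    [M * cauchy w]; then in [u], with majorant [M * pi * |g1 u|]. *)
Lemma cvg_poisson g1 g2 : integ g1 -> admissible g2 ->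
  (fun n => \intR (fun u => g1 u * \intR (fun v => g2 v * poisson (eps n) (u - v))))
  @ \oo --> pi * \intR (fun u => g1 u * g2 u).
Proof.
move=> I1 [M [I2 B2 C2]]; have [Ic Ec] := integ_cauchy.
have m2 := integ_mfun I2.
have M0 : 0 <= M by exact: le_trans (normr_ge0 _) (B2 0).
have mc : mfun cauchy by exact: integ_mfun Ic.
pose Q n u := \intR (fun w => g2 (eps n * w + u) * cauchy w).
have IQ n u : integ (fun w => g2 (eps n * w + u) * cauchy w).
  apply: (@integ_bounded _ (fun w => g2 (eps n * w + u)) cauchy M) => //.
  exact: (measurableT_comp m2 (measurable_affine _ _)).
have QM n u : `|Q n u| <= M * pi.
  rewrite /Q (le_trans (le_normr_Rintegral measurableT (IQ n u)))// -Ec.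
  rewrite -(RintegralZl _ measurableT Ic); apply: le_Rintegral => //.
  - exact: integrable_norm.
  - exact: integ_scale.
  - by move=> w _; rewrite normrM (gtr0_norm (cauchy_gt0 w)) ler_wpM2r// ltW.
have mQ n : mfun (Q n).
  have := @measurable_param _ cauchy (fun x => g2 (eps n * x.2 + x.1)) M Ic _ _.
  rewrite /Q; under [X in _ -> _ -> mfun X]eq_fun do under eq_Rintegral do rewrite mulrC.
  apply=> [|x]; last exact: B2.
  apply: measurableT_comp => //; apply: measurable_funD; last exact: measurable_fst.
  by apply: measurable_funM => //; exact: measurable_snd.
have Q_cvg u : ~ A u -> Q ^~ u @ \oo --> pi * g2 u.
  move=> Au.
  have [||||_] := @intR_dominated _ (fun n w => g2 (eps n * w + u) * cauchy w)
    (fun w => g2 u * cauchy w) (fun w => M * cauchy w) _ _ _ (integ_scale M Ic).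
  - by move=> n; exact: integ_mfun (IQ n u).
  - exact: measurable_funM.
  - apply: aeW => w; apply: cvgM; last exact: cvg_cst.
    apply: (@cvg_comp _ _ _ (fun n => eps n * w + u) g2 _ (nbhs u)); last exact: C2.
    have : eps n * w + u @[n --> \oo] --> 0 * w + u.
      apply: cvgD; last exact: cvg_cst.
      by apply: cvgM; [exact: cvg_eps|exact: cvg_cst].
    by rewrite mul0r add0r.
  - by move=> n w; rewrite normrM (gtr0_norm (cauchy_gt0 w)) ler_wpM2r// ltW.
  by rewrite (RintegralZl _ measurableT Ic) Ec mulrC.
have m1 := integ_mfun I1.
have I12 : integ (fun u => g1 u * g2 u).
  by under eq_fun do rewrite mulrC; exact: integ_bounded B2 I1.
rewrite -(RintegralZl _ measurableT I12).
have [||||_] := @intR_dominated _ (fun n u => g1 u * Q n u)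
  (fun u => pi * (g1 u * g2 u)) (fun u => M * pi * `|g1 u|) _ _ _
  (integ_scale _ (integrable_norm I1)).
- by move=> n; exact: measurable_funM.
- by apply: measurable_funM => //; exact: measurable_funM.
- apply: (ae_notin_countable countA) => u Au; rewrite mulrCA.
  by apply: cvgM; [exact: cvg_cst|exact: Q_cvg].
- by move=> n u; rewrite normrM mulrC ler_wpM2r.
have E n : \intR (fun u => g1 u * \intR (fun v => g2 v * poisson (eps n) (u - v))) =
    \intR (fun u => g1 u * Q n u).
  congr (\intR _); apply/funext => u.
  by rewrite (poisson_rescale _ (eps_gt0 n) I2).
move=> H; have EE := funext E; rewrite EE; exact: H.
Qed.

Lemma cvg_regularized g1 g2 : integ g1 -> admissible g2 ->
  (fun n => \intR (fun t => heaviside t * expR (- eps n * t) *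
    (Fcos g1 t * Fcos g2 t + Fsin g1 t * Fsin g2 t)))
  @ \oo --> pi * \intR (fun u => g1 u * g2 u).
Proof.
move=> I1 A2; have [M [I2 _ _]] := A2.
under eq_fun do rewrite (regularized_parseval (eps_gt0 _) I1 I2).
exact: cvg_poisson.
Qed.

Let power g t := Fcos g t ^+ 2 + Fsin g t ^+ 2.

Let integ_reg g1 g2 n : integ g1 -> integ g2 -> integ (fun t => heaviside t * expR (- eps n * t) *
    (Fcos g1 t * Fcos g2 t + Fsin g1 t * Fsin g2 t)).
Proof.
move=> I1 I2; have Ie := integ_exp_halfline (eps_gt0 n).
under eq_fun do rewrite mulrC.
apply: (@integ_bounded _ (fun t => Fcos g1 t * Fcos g2 t + Fsin g1 t * Fsin g2 t) _
  (\intR (fun u => `|g1 u|) * \intR (fun u => `|g2 u|) +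
   \intR (fun u => `|g1 u|) * \intR (fun u => `|g2 u|))) => //.
- have mc1 := measurable_Fcos I1; have mc2 := measurable_Fcos I2.
  have ms1 := measurable_Fsin I1; have ms2 := measurable_Fsin I2.
  by apply: measurable_funD; exact: measurable_funM.
- move=> t; rewrite (le_trans (ler_normD _ _))// !normrM lerD//.
    exact: ler_pM (Fcos_bound t I1) (Fcos_bound t I2).
  exact: ler_pM (Fsin_bound t I1) (Fsin_bound t I2).
Qed.

Let cvg_weight t : 0 <= t -> expR (- eps n * t) @[n --> \oo] --> (1 : R).
Proof.
move=> t0; rewrite -expR0.
apply: (@cvg_comp _ _ _ (fun n => - eps n * t) expR _ (nbhs 0)); last first.
  exact: continuous_expR.
rewrite -(mul0r t); apply: cvgM; last exact: cvg_cst.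
by rewrite -oppr0; apply: cvgN; exact: cvg_eps.
Qed.

(** For [g1 = g2 = g] the weighted integrands are non-negative and increase with [n]. Their
    integrals tend to that of [power g] over the half-line by monotone convergence and to a finite
    number by [cvg_regularized]. *)
Lemma integ_power g : admissible g -> integ (fun t => heaviside t * power g t).
Proof.
move=> Ag; have [M [Ig _ _]] := Ag.
have mp : mfun (fun t => heaviside t * power g t).
  apply: measurable_funM; first exact: measurable_heaviside.
  apply: measurable_funD; apply: measurable_funX.
    exact: measurable_Fcos.
  exact: measurable_Fsin.
have p0 t : 0 <= power g t by rewrite addr_ge0 ?sqr_ge0.
pose f n t := heaviside t * expR (- eps n * t) *
  (Fcos g t * Fcos g t + Fsin g t * Fsin g t).
have fE n t : f n t = heaviside t * expR (- eps n * t) * power g t.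
  by rewrite /f /power !expr2.
have If n : integ (f n) by exact: integ_reg.
have floor_exp t : (f n t)%:E @[n --> \oo] --> (heaviside t * power g t)%:E.
  apply: cvg_EFin; first exact: nearW.
  under eq_fun do rewrite /= fE.
  rewrite /heaviside; have [t0|_] := leP 0 t; last first.
    by under eq_fun do rewrite !mul0r; rewrite !mul0r; exact: cvg_cst.
  under eq_fun do rewrite mul1r; apply: cvgM; last exact: cvg_cst.
  exact: cvg_weight.
have L : (fun n => \int[lebR]_t (f n t)%:E)%E @ \oo --> (\int[lebR]_t (heaviside t * power g t)%:E)%E.
  have <- : (\int[lebR]_t limn (fun n => (f n t)%:E) = \int[lebR]_t (heaviside t * power g t)%:E)%E.
    by apply: eq_integral => t _; apply/cvg_lim => //; exact: floor_exp.
  apply: (@cvg_monotone_convergence _ _ _ lebR setT measurableT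
    (fun n t => (f n t)%:E)).
  - by move=> n; exact: measurable_int (If n).
  - by move=> n t _; rewrite lee_fin fE !mulr_ge0// expR_ge0.
  - move=> t _ m n mn; rewrite lee_fin !fE ler_wpM2r// /heaviside.
    have [t0|_] := leP 0 t; last by rewrite !mul0r.
    rewrite !mul1r ler_expR ler_wpM2r// lerN2 lef_pV2 ?posrE//.
    by rewrite ler_nat ltnS.
have L2 : (fun n => \int[lebR]_t (f n t)%:E)%E @ \oo --> (pi * \intR (fun u => g u * g u))%:E.
  apply: cvg_EFin; last exact: cvg_regularized.
  by apply: nearW => n; exact: (integrable_fin_num measurableT (If n)).
have E := cvg_unique (@ereal_hausdorff R) L L2.
apply/integrableP; split; first exact/measurable_EFinP.
rewrite [ltLHS](_ : _ = (pi * \intR (fun u => g u * g u))%:E) ?ltry// -E.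
by apply: eq_integral => t _ /=; rewrite ger0_norm// mulr_ge0.
Qed.

(** The two integrands are the real and imaginary parts of the transform of [g1] times the conjugate
    of that of [g2]. Both are dominated by [power g1 + power g2], which permits removing the weight.
    The first is even, whence the factor 2; the second is odd and integrates to 0. *)
Theorem parseval g1 g2 : admissible g1 -> admissible g2 ->
  [/\ integ (fun t => Fcos g1 t * Fcos g2 t + Fsin g1 t * Fsin g2 t),
      \intR (fun t => Fcos g1 t * Fcos g2 t + Fsin g1 t * Fsin g2 t) =
        2 * pi * \intR (fun u => g1 u * g2 u),
      integ (fun t => Fcos g1 t * Fsin g2 t - Fsin g1 t * Fcos g2 t) &
      \intR (fun t => Fcos g1 t * Fsin g2 t - Fsin g1 t * Fcos g2 t) = 0].
Proof.
move=> A1 A2; have [_ [I1 _ _]] := A1; have [_ [I2 _ _]] := A2.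
have mc1 := measurable_Fcos I1; have mc2 := measurable_Fcos I2.
have ms1 := measurable_Fsin I1; have ms2 := measurable_Fsin I2.
pose H t := heaviside t * power g1 t + heaviside t * power g2 t.
have IH : integ H by apply: integD; exact: integ_power.
pose F t := Fcos g1 t * Fcos g2 t + Fsin g1 t * Fsin g2 t.
pose G t := Fcos g1 t * Fsin g2 t - Fsin g1 t * Fcos g2 t.
have mF : mfun F by apply: measurable_funD; exact: measurable_funM.
have mG : mfun G by apply: measurable_funB; exact: measurable_funM.
have amgm (a b c d : R) : `|a * b + c * d| <= (a ^+ 2 + c ^+ 2) + (b ^+ 2 + d ^+ 2).
  rewrite ler_norml; apply/andP; split.
    by have := sqr_ge0 (a + b); have := sqr_ge0 (c + d);
       have := sqr_ge0 (a - b); have := sqr_ge0 (c - d); rewrite !expr2; nra.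
  by have := sqr_ge0 (a + b); have := sqr_ge0 (c + d);
     have := sqr_ge0 (a - b); have := sqr_ge0 (c - d); rewrite !expr2; nra.
have FH t : `|heaviside t * F t| <= H t.
  by rewrite /H -mulrDr normrM (ger0_norm (heaviside_ge0 t)) ler_wpM2l// amgm.
have GH t : `|heaviside t * G t| <= H t.
  rewrite /H -mulrDr normrM (ger0_norm (heaviside_ge0 t)) ler_wpM2l//.
  have := amgm (Fcos g1 t) (Fsin g2 t) (- Fsin g1 t) (Fcos g2 t).
  by rewrite mulNr sqrrN => /le_trans; apply; rewrite /power; lra.
have IhF : integ (fun t => heaviside t * F t).
  by apply: integ_le FH IH; apply: measurable_funM => //; exact: measurable_heaviside.
have IhG : integ (fun t => heaviside t * G t).
  by apply: integ_le GH IH; apply: measurable_funM => //; exact: measurable_heaviside.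
have FN t : F (- t) = F t by rewrite /F !FcosN !FsinN// mulrNN.
have GN t : G (- t) = - G t by rewrite /G !FcosN !FsinN//; ring.
have [IF EF] := integ_even_norm mF (fun t => congr1 Num.norm (FN t)) IhF.
have GN' t : `|G (- t)| = `|G t| by rewrite GN normrN.
have [IG EG] := integ_even_norm mG GN' IhG.
split=> //.
- have [||||_ L] := @intR_dominated _ (fun n t => heaviside t * expR (- eps n * t) * F t)
    (fun t => heaviside t * F t) H _ _ _ IH.
  + by move=> n; exact: integ_mfun (integ_reg n I1 I2).
  + exact: integ_mfun IhF.
  + apply: aeW => t; rewrite /heaviside; have [t0|_] := leP 0 t; last first.
      by under eq_fun do rewrite !mul0r; rewrite !mul0r; exact: cvg_cst.
    under eq_fun do rewrite mul1r; apply: cvgM; last exact: cvg_cst.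
    exact: cvg_weight.
  + move=> n t; apply: le_trans (FH t); rewrite /heaviside.
    have [t0|_] := leP 0 t; last by rewrite !mul0r.
    rewrite !mul1r normrM ler_piMl// ger0_norm ?expR_ge0//.
    by rewrite -expR0 ler_expR mulNr oppr_le0 mulr_ge0// ltW.
  have E := cvg_unique (@Rhausdorff R) L (cvg_regularized I1 A2).
  rewrite EF (_ : (fun t => heaviside t * F (- t)) = (fun t => heaviside t * F t)); last first.
    by apply/funext => t; rewrite FN.
  by rewrite E; ring.
- rewrite EG (_ : (fun t => heaviside t * G (- t)) = (fun t => -1 * (heaviside t * G t))); last first.
    by apply/funext => t; rewrite GN mulN1r mulrN.
  by rewrite (RintegralZl _ measurableT IhG) mulN1r subrr.
Qed.

End plancherel.

(** * Laplace transforms and the zeta function *)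

Section laplace.
Context {R : realType}.
Implicit Types (g b : R -> R) (s t u v c k : R).

(** The integral of [b u] times exp(-(s + it)u) over the whole line, seen as the Fourier transform
    of [b u * expR (- s * u)]: Parseval's formula applies to it directly. *)
Definition laplace b s t : R[i] :=
  Fcos (fun u => b u * expR (- s * u)) t -i* Fsin (fun u => b u * expR (- s * u)) t.

Local Notation laplace_integ b s := (integ (fun u => b u * expR (- s * u))).

Lemma complexP (z w : R[i]) : complex.Re z = complex.Re w ->
  complex.Im z = complex.Im w -> z = w.
Proof. by case: z w => [a b] [c d] /= -> ->. Qed.

Lemma Fcos_lin g1 g2 k t : integ g1 -> integ g2 ->
  Fcos (fun u => g1 u + k * g2 u) t = Fcos g1 t + k * Fcos g2 t.
Proof.
move=> I1 I2; have J1 := integ_cosM t I1; have J2 := integ_cosM t I2.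
rewrite /Fcos -(RintegralZl _ measurableT J2).
rewrite -(RintegralD measurableT J1 (integ_scale k J2)).
by congr (\intR _); apply/funext => u; rewrite mulrDl mulrA.
Qed.

Lemma Fsin_lin g1 g2 k t : integ g1 -> integ g2 ->
  Fsin (fun u => g1 u + k * g2 u) t = Fsin g1 t + k * Fsin g2 t.
Proof.
move=> I1 I2; have J1 := integ_sinM t I1; have J2 := integ_sinM t I2.
rewrite /Fsin -(RintegralZl _ measurableT J2).
rewrite -(RintegralD measurableT J1 (integ_scale k J2)).
by congr (\intR _); apply/funext => u; rewrite mulrDl mulrA.
Qed.

Lemma laplace_lin b1 b2 k s t : laplace_integ b1 s -> laplace_integ b2 s ->
  laplace (fun u => b1 u + k * b2 u) s t = laplace b1 s t + k%:C * laplace b2 s t.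
Proof.
move=> I1 I2; rewrite /laplace.
have -> : (fun u => (b1 u + k * b2 u) * expR (- s * u)) =
    (fun u => b1 u * expR (- s * u) + k * (b2 u * expR (- s * u))).
  by apply/funext => u; rewrite mulrDl mulrA.
by rewrite Fcos_lin// Fsin_lin//; apply: complexP => /=; ring.
Qed.

Lemma laplace_integ_lin b1 b2 k s :
  laplace_integ b1 s -> laplace_integ b2 s ->
  laplace_integ (fun u => b1 u + k * b2 u) s.
Proof.
move=> I1 I2; under eq_fun do rewrite mulrDl -mulrA.
exact: integD I1 (integ_scale k I2).
Qed.

Lemma intR_shift g c : integ g -> \intR g = \intR (fun u => g (u + c)).
Proof.
move=> Ig; rewrite (intR_affine c (oner_neq0 R) Ig) normr1 mul1r.
by congr (\intR _); apply/funext => u; rewrite mul1r.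
Qed.

Lemma integ_shift g c : integ g -> integ (fun u => g (u + c)).
Proof.
move=> Ig; have := integ_affine c (oner_neq0 R) Ig.
by under eq_fun do rewrite mul1r.
Qed.

Lemma laplace_integ_shift b s c : laplace_integ b s -> laplace_integ (fun u => b (u - c)) s.
Proof.
move=> Ib; have := integ_scale (expR (- s * c)) (integ_shift (- c) Ib).
congr (integ _); apply/funext => u; rewrite mulrCA -expRD; congr (_ * expR _); ring.
Qed.

(** The factor is left as [expC]: for [c = ln k] it unfolds to the power [cpow k (- (s +i* t))]. *)
Lemma laplace_shift b s t c : laplace_integ b s ->
  laplace (fun u => b (u - c)) s t = expC (- (s +i* t) * c%:C) * laplace b s t.
Proof.
move=> Ib; have Ibc := laplace_integ_shift c Ib.
have Jc := integ_cosM t Ib; have Js := integ_sinM t Ib.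
have Ec : Fcos (fun u => b (u - c) * expR (- s * u)) t = expR (- s * c) *
   (cos (t * c) * Fcos (fun u => b u * expR (- s * u)) t -
    sin (t * c) * Fsin (fun u => b u * expR (- s * u)) t).
  rewrite {1}/Fcos (intR_shift c (integ_cosM t Ibc)).
  rewrite /Fcos /Fsin -(RintegralZl _ measurableT Jc) -(RintegralZl _ measurableT Js).
  rewrite -(RintegralB measurableT (integ_scale _ Jc) (integ_scale _ Js)).
  rewrite -(RintegralZl _ measurableT (integB (integ_scale _ Jc) (integ_scale _ Js))).
  congr (\intR _); apply/funext => u; rewrite addrK !mulrDr expRD cosD; ring.
have Es : Fsin (fun u => b (u - c) * expR (- s * u)) t = expR (- s * c) *
   (cos (t * c) * Fsin (fun u => b u * expR (- s * u)) t +
    sin (t * c) * Fcos (fun u => b u * expR (- s * u)) t).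
  rewrite {1}/Fsin (intR_shift c (integ_sinM t Ibc)).
  rewrite /Fcos /Fsin -(RintegralZl _ measurableT Jc) -(RintegralZl _ measurableT Js).
  rewrite -(RintegralD measurableT (integ_scale _ Js) (integ_scale _ Jc)).
  rewrite -(RintegralZl _ measurableT (integD (integ_scale _ Js) (integ_scale _ Jc))).
  congr (\intR _); apply/funext => u; rewrite addrK !mulrDr expRD sinD; ring.
rewrite /laplace Ec Es /expC /=.
have -> : - s * c - - t * 0 = - s * c by ring.
have -> : - s * 0 + - t * c = - (t * c) by ring.
rewrite cosN sinN; apply: complexP => /=; ring.
Qed.

Lemma laplace_heaviside s t : 0 < s -> laplace heaviside s t = (s +i* t)^-1.
Proof.
move=> s0; have d0 := sqr_add_gt0 t s0; set z := s +i* t.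
have z0 : z != 0 by rewrite eq_complex/= gt_eqF.
rewrite /laplace /Fcos /Fsin; under eq_Rintegral do rewrite -mulrA.
under [X in _ -i* X]eq_Rintegral do rewrite -mulrA.
rewrite intR_expcos// intR_expsin//; by apply: (mulfI z0); rewrite mulfV.
Qed.

Lemma laplace_integ_heaviside s : 0 < s -> laplace_integ heaviside s.
Proof. exact: integ_exp_halfline. Qed.

Lemma mul_expR_shift b s : (fun u => b u * expR u * expR (- s * u)) =
  (fun u => b u * expR (- (s - 1) * u)).
Proof.
by apply/funext => u; rewrite -mulrA -expRD; congr (_ * expR _); ring.
Qed.

Lemma laplace_expR b s t : laplace (fun u => b u * expR u) s t = laplace b (s - 1) t.
Proof. by rewrite /laplace mul_expR_shift. Qed.

Lemma reflected_exp b s : (fun u => b (- u) * expR (- s * u)) =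
  (fun u => (fun v => b v * expR (- - s * v)) (-1 * u + 0)).
Proof.
by apply/funext => u /=; rewrite addr0 mulN1r opprK mulrN mulNr.
Qed.

Lemma laplace_integ_refl b s : laplace_integ b (- s) -> laplace_integ (fun u => b (- u)) s.
Proof.
move=> Ib; rewrite reflected_exp; apply: integ_affine Ib.
by rewrite oppr_eq0 oner_eq0.
Qed.

Lemma laplace_refl b s t : laplace_integ b (- s) ->
  laplace (fun u => b (- u)) s t = laplace b (- s) (- t).
Proof.
move=> Ib; have N10 : (-1 : R) != 0 by rewrite oppr_eq0 oner_eq0.
rewrite /laplace /Fcos /Fsin (intR_affine 0 N10 (integ_cosM (- t) Ib)).
rewrite (intR_affine 0 N10 (integ_sinM (- t) Ib)) normrN normr1 !mul1r.
congr (_ +i* - _); congr (\intR _); apply/funext => u; rewrite addr0 mulN1r opprK.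
  by rewrite mulrNN mulrN mulNr.
by rewrite mulrNN mulrN mulNr.
Qed.

Lemma laplace_ae b1 b2 s t (A : set R) : countable A -> (forall u, ~ A u -> b1 u = b2 u) ->
  laplace_integ b1 s -> laplace_integ b2 s -> laplace b1 s t = laplace b2 s t.
Proof.
move=> cA Ab I1 I2; rewrite /laplace /Fcos /Fsin; congr (_ +i* - _); apply: intR_ae_eq.
- exact: integ_mfun (integ_cosM t I1).
- exact: integ_mfun (integ_cosM t I2).
- by apply: (ae_notin_countable cA) => u /Ab ->.
- exact: integ_mfun (integ_sinM t I1).
- exact: integ_mfun (integ_sinM t I2).
- by apply: (ae_notin_countable cA) => u /Ab ->.
Qed.

(** * Integer and fractional parts of the exponential *)

Definition floor_exp u : R := (Num.truncn (expR u))%:R.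
Definition fract_exp u : R := expR u - floor_exp u.

Lemma truncn_expR_lt0 u : u < 0 -> Num.truncn (expR u) = 0%N.
Proof. by move=> u0; apply: truncn_def; rewrite expR_ge0 expR_lt1. Qed.

Lemma floor_exp_lt0 u : u < 0 -> floor_exp u = 0.
Proof. by move=> u0; rewrite /floor_exp truncn_expR_lt0. Qed.

Lemma heaviside_floor_exp u : heaviside u * floor_exp u = floor_exp u.
Proof. by rewrite /heaviside; have [_|/floor_exp_lt0->] := leP 0 u; rewrite ?mul1r ?mulr0. Qed.

Lemma floor_exp_ge0 u : 0 <= floor_exp u. Proof. by []. Qed.

Lemma floor_exp_le u : floor_exp u <= expR u. Proof. by rewrite truncn_le expR_ge0. Qed.

Lemma fract_exp_ge0 u : 0 <= fract_exp u. Proof. by rewrite subr_ge0 floor_exp_le. Qed.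

Lemma fract_exp_le1 u : fract_exp u <= 1.
Proof. by rewrite /fract_exp lerBlDr nat1r ltW// truncnS_gt. Qed.

Lemma norm_fract_exp_le1 u : `|fract_exp u| <= 1.
Proof. by rewrite ger0_norm ?fract_exp_ge0 ?fract_exp_le1. Qed.

Lemma measurable_floor_exp : mfun floor_exp.
Proof.
by apply: nondecreasing_measurable => // x y xy; rewrite ler_nat le_truncn ?ler_expR.
Qed.

Lemma measurable_fract_exp : mfun fract_exp.
Proof.
apply: measurable_funB; last exact: measurable_floor_exp.
by apply: continuous_measurable_fun; exact: continuous_expR.
Qed.

Lemma measurable_exp s : mfun (fun u => expR (- s * u)).
Proof. by apply: continuous_measurable_fun; exact: continuous_expRN. Qed.

Lemma laplace_integ_heavisideM b s : mfun b -> (forall u, `|b u| <= 1) -> 0 < s ->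
  laplace_integ (fun u => heaviside u * b u) s.
Proof.
move=> mb b1 s0; apply: (integ_le _ _ (integ_exp_halfline s0)).
  apply: measurable_funM; last exact: measurable_exp.
  by apply: measurable_funM => //; exact: measurable_heaviside.
move=> u; rewrite normrM (ger0_norm (expR_ge0 _)) ler_wpM2r ?expR_ge0//.
by rewrite normrM (ger0_norm (heaviside_ge0 u)) ler_piMr.
Qed.

Lemma laplace_integ_floor_exp s : 1 < s -> laplace_integ floor_exp s.
Proof.
move=> s1; have s0 : 0 < s - 1 by rewrite subr_gt0.
apply: (integ_le _ _ (integ_exp_halfline s0)).
  by apply: measurable_funM; [exact: measurable_floor_exp|exact: measurable_exp].
move=> u; rewrite normrM (ger0_norm (expR_ge0 _)) (ger0_norm (floor_exp_ge0 u)).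
rewrite -heaviside_floor_exp -mulrA.
have /(congr1 (fun f => f u)) := mul_expR_shift (fun=> 1) s; rewrite !mul1r => <-.
by rewrite ler_wpM2l// ler_wpM2r ?expR_ge0// floor_exp_le.
Qed.

(** As a function of [N] the minimum is eventually constant and never exceeds the integer part: this
    gives both the pointwise limit and the majorant in [cvg_laplace_sum_heaviside]. *)
Lemma sum_heaviside_ln u N : \sum_(0 <= n < N) heaviside (u - ln n.+1%:R) =
  (minn N (Num.truncn (expR u)))%:R.
Proof.
have E n : heaviside (u - ln n.+1%:R) = ((n < Num.truncn (expR u))%N)%:R.
  rewrite truncn_gt_nat /heaviside subr_ge0; congr ((nat_of_bool _)%:R).
  by rewrite -[RHS]ler_ln ?posrE ?expR_gt0// expRK.
under eq_bigr do rewrite E.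
elim: N => [|N IH]; first by rewrite big_geq// min0n.
rewrite big_nat_recr//= IH -natrD; congr (_%:R); set m := Num.truncn _.
case: (ltnP N m) => Nm.
  by rewrite (minn_idPl Nm) addn1.
by rewrite (minn_idPr (leqW Nm)) addn0.
Qed.

Lemma expC_cpow n s t : expC (- (s +i* t) * (ln n.+1%:R)%:C) = cpow n.+1%:R (- (s +i* t)).
Proof. by []. Qed.

Lemma laplace_integ_sum_heaviside s N : 0 < s ->
  laplace_integ (fun u => \sum_(0 <= n < N) heaviside (u - ln n.+1%:R)) s.
Proof.
move=> s0; elim: N => [|N IH].
  by under eq_fun do rewrite big_geq// mul0r; exact: integrable0.
under eq_fun do rewrite big_nat_recr//= -[X in _ + X]mul1r.
apply: laplace_integ_lin => //; exact: (laplace_integ_shift _ (laplace_integ_heaviside s0)).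
Qed.

Lemma laplace_sum_heaviside s t N : 0 < s ->
  laplace (fun u => \sum_(0 <= n < N) heaviside (u - ln n.+1%:R)) s t =
  (\sum_(0 <= n < N) cpow n.+1%:R (- (s +i* t))) / (s +i* t).
Proof.
move=> s0; elim: N => [|N IH].
  rewrite big_geq// mul0r /laplace.
  have -> : (fun u => (\sum_(0 <= n < 0) heaviside (u - ln n.+1%:R)) * expR (- s * u)) =
      (fun=> 0).
    by apply/funext => u; rewrite big_geq// mul0r.
  rewrite /Fcos /Fsin.
  under eq_Rintegral do rewrite mul0r.
  under [X in _ -i* X]eq_Rintegral do rewrite mul0r.
  by rewrite Rintegral_cst// mul0r; apply: complexP => /=; rewrite ?oppr0.
have Ih := laplace_integ_shift (ln N.+1%:R) (laplace_integ_heaviside s0).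
transitivity (laplace (fun u => \sum_(0 <= n < N) heaviside (u - ln n.+1%:R) +
    1 * heaviside (u - ln N.+1%:R)) s t).
  by congr laplace; apply/funext => u; rewrite big_nat_recr//= mul1r.
rewrite (laplace_lin _ _ (laplace_integ_sum_heaviside N s0) Ih) IH.
rewrite (laplace_shift _ _ (laplace_integ_heaviside s0)) laplace_heaviside//.
by rewrite big_nat_recr//= mul1r mulrDl expC_cpow.
Qed.

(** The partial sums are dominated by [floor_exp u * expR (- s * u)], integrable for [1 < s]. Up to
    the factor [s +i* t] these transforms are the partial sums of the Dirichlet series. *)
Lemma cvg_laplace_sum_heaviside s t : 1 < s ->
  (fun N => complex.Re (laplace (fun u => \sum_(0 <= n < N) heaviside (u - ln n.+1%:R)) s t))
    @ \oo --> complex.Re (laplace floor_exp s t) /\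
  (fun N => complex.Im (laplace (fun u => \sum_(0 <= n < N) heaviside (u - ln n.+1%:R)) s t))
    @ \oo --> complex.Im (laplace floor_exp s t).
Proof.
move=> s1; have s0 : 0 < s by rewrite (lt_trans ltr01).
have If := laplace_integ_floor_exp s1.
pose S N u := (\sum_(0 <= n < N) heaviside (u - ln n.+1%:R)) * expR (- s * u).
have IS N : integ (S N) by exact: laplace_integ_sum_heaviside.
have cS u : S ^~ u @ \oo --> floor_exp u * expR (- s * u).
  apply: cvgM; last exact: cvg_cst.
  apply: cvg_near_cst; exists (Num.truncn (expR u)) => // N /= uN.
  by rewrite sum_heaviside_ln (minn_idPr uN).
have bS N u : `|S N u| <= floor_exp u * expR (- s * u).
  rewrite /S sum_heaviside_ln ger0_norm; last by rewrite mulr_ge0// expR_ge0.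
  by rewrite ler_wpM2r ?expR_ge0// ler_nat geq_minr.
split=> /=.
- have [||||_] := @intR_dominated _ (fun N u => S N u * cos (t * u))
    (fun u => floor_exp u * expR (- s * u) * cos (t * u)) _ _ _ _ If.
  + by move=> N; exact: integ_mfun (integ_cosM t (IS N)).
  + exact: integ_mfun (integ_cosM t If).
  + by apply: aeW => u; apply: cvgM; [exact: cS|exact: cvg_cst].
  + move=> N u; rewrite normrM (le_trans _ (bS N u))// ler_piMr//.
    exact: norm_cos_le1.
  exact.
- have [||||_ H] := @intR_dominated _ (fun N u => S N u * sin (t * u))
    (fun u => floor_exp u * expR (- s * u) * sin (t * u)) _ _ _ _ If.
  + by move=> N; exact: integ_mfun (integ_sinM t (IS N)).
  + exact: integ_mfun (integ_sinM t If).
  + by apply: aeW => u; apply: cvgM; [exact: cS|exact: cvg_cst].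
  + move=> N u; rewrite normrM (le_trans _ (bS N u))// ler_piMr//.
    exact: norm_sin_le1.
  by apply: cvgN; exact: H.
Qed.

Lemma heaviside_fract_exp : (fun u => heaviside u * fract_exp u) =
  (fun u => heaviside u * expR u + -1 * floor_exp u).
Proof. by apply/funext => u; rewrite /fract_exp mulrBr heaviside_floor_exp mulN1r. Qed.

(** The half-line transform converges for every [s > 0], so it covers both the half-plane of the
    Dirichlet series and the critical strip. *)
Definition laplace_fract s t := laplace (fun u => heaviside u * fract_exp u) s t.

(** * Zeta as a transform of the fractional part *)

Section zeta.
Variables (zeta : R[i] -> R[i]) (hzeta : is_riemann_zeta zeta).

Lemma zeta_laplace_floor_exp s t : 1 < s -> zeta (s +i* t) = (s +i* t) * laplace floor_exp s t.
Proof.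
move=> s1; have s0 : 0 < s by rewrite (lt_trans ltr01).
have Z := hzeta.1 (s +i* t) s1.
have z0 : s +i* t != 0 by rewrite eq_complex/= gt_eqF.
set A := fun N => laplace (fun u => \sum_(0 <= n < N) heaviside (u - ln n.+1%:R)) s t.
have ZA N : series (fun n => cpow n.+1%:R (- (s +i* t))) N = (s +i* t) * A N.
  by rewrite /A laplace_sum_heaviside// mulrCA mulfV// mulr1.
have [cR cI] := cvg_laplace_sum_heaviside t s1.
apply: complexP.
- have := cvg_Re Z; under eq_fun do rewrite ZA.
  move=> H; apply: (cvg_unique (@Rhausdorff R) H).
  rewrite (_ : (fun N => _) = (fun N => s * complex.Re (A N) - t * complex.Im (A N))); last first.
    by apply/funext => N; case: (A N).
  rewrite (_ : complex.Re _ = s * complex.Re (laplace floor_exp s t) - t * complex.Im (laplace floor_exp s t)); last first.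
    by case: (laplace floor_exp s t).
  by apply: cvgB; apply: cvgM => //; exact: cvg_cst.
- have := cvg_Im Z; under eq_fun do rewrite ZA.
  move=> H; apply: (cvg_unique (@Rhausdorff R) H).
  rewrite (_ : (fun N => _) = (fun N => s * complex.Im (A N) + t * complex.Re (A N))); last first.
    by apply/funext => N; case: (A N).
  rewrite (_ : complex.Im _ = s * complex.Im (laplace floor_exp s t) + t * complex.Re (laplace floor_exp s t)); last first.
    by case: (laplace floor_exp s t).
  by apply: cvgD; apply: cvgM => //; exact: cvg_cst.
Qed.

(** With [z = s +i* t], the transform of [expR] over the half-line is 1/(z - 1) and that of
    [floor_exp] is zeta(z)/z. Denominators are cleared so that only polynomial factors meet analytic
    functions in the continuation. *)
Lemma zeta_laplace_fract_gt1 s t : 1 < s ->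
  (s +i* t - 1) * zeta (s +i* t) - (s +i* t) + (s +i* t) * (s +i* t - 1) * laplace_fract s t = 0.
Proof.
move=> s1; have s0 : 0 < s - 1 by rewrite subr_gt0.
rewrite zeta_laplace_floor_exp// /laplace_fract heaviside_fract_exp.
have Ie : laplace_integ (fun u => heaviside u * expR u) s.
  by rewrite mul_expR_shift; exact: laplace_integ_heaviside.
rewrite (laplace_lin _ _ Ie (laplace_integ_floor_exp s1)) laplace_expR laplace_heaviside//.
have -> : (s - 1) +i* t = s +i* t - 1 by apply: complexP => /=; ring.
have z0 : s +i* t - 1 != 0 by rewrite eq_complex/= gt_eqF.
have -> : (-1)%:C = -1 :> R[i] by apply: complexP => /=; ring.
by field.
Qed.

(** For fixed [t] the oscillating factor is grouped with the bounded one, the form in which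
    [laplace_ranalytic] applies to the variable [s]. *)
Lemma laplace_fractE s t : laplace_fract s t =
  (\intR (fun u => heaviside u * (fract_exp u * cos (t * u) * expR (- s * u)))) -i*
  (\intR (fun u => heaviside u * (fract_exp u * sin (t * u) * expR (- s * u)))).
Proof.
by rewrite /laplace_fract /laplace /Fcos /Fsin; congr (_ +i* - _); congr (\intR _);
  apply/funext => u; ring.
Qed.

Lemma ranalytic_laplace_fract s t : 0 < s ->
  ranalytic (fun s => complex.Re (laplace_fract s t)) s /\
  ranalytic (fun s => complex.Im (laplace_fract s t)) s.
Proof.
move=> s0; have mt : mfun (fun u => t * u) by apply: measurable_funM.
split.
- rewrite (_ : (fun s => _) = (fun s => \intR (fun u => heaviside u * (fract_exp u * cos (t * u) * expR (- s * u))))).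
    apply: (@laplace_ranalytic _ _ 1) => //.
      apply: measurable_funM; first exact: measurable_fract_exp.
      exact: (measurableT_comp measurable_cos mt).
    by move=> u; rewrite normrM -[leRHS]mulr1 ler_pM ?norm_fract_exp_le1 ?norm_cos_le1.
  by apply/funext => x; rewrite laplace_fractE.
- rewrite (_ : (fun s => _) = (fun s => -1 * \intR (fun u => heaviside u * (fract_exp u * sin (t * u) * expR (- s * u))))).
    apply: ranalyticZ; apply: (@laplace_ranalytic _ _ 1) => //.
      apply: measurable_funM; first exact: measurable_fract_exp.
      exact: (measurableT_comp measurable_sin mt).
    by move=> u; rewrite normrM -[leRHS]mulr1 ler_pM ?norm_fract_exp_le1 ?norm_sin_le1.
  by apply/funext => x; rewrite laplace_fractE /= mulN1r.
Qed.

(** As [t] is not 0, the horizontal line avoids the pole. The left-hand side [E] has real-analytic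
    real and imaginary parts for [s > 0], and they vanish for [s > 1]. *)
Lemma zeta_laplace_fract s t : t != 0 -> 0 < s ->
  (s +i* t - 1) * zeta (s +i* t) - (s +i* t) + (s +i* t) * (s +i* t - 1) * laplace_fract s t = 0.
Proof.
move=> t0 s0.
pose Zr x := complex.Re (zeta (x +i* t)); pose Zi x := complex.Im (zeta (x +i* t)).
pose P x := complex.Re (laplace_fract x t); pose Q x := complex.Im (laplace_fract x t).
pose E x := (x +i* t - 1) * zeta (x +i* t) - (x +i* t) +
  (x +i* t) * (x +i* t - 1) * laplace_fract x t.
have aZ x : ranalytic Zr x /\ ranalytic Zi x.
  by apply/analytic_ReIm/hzeta.2; rewrite eq_complex/= (negbTE t0) andbF.
have E1 x : 1 < x -> E x = 0 by exact: zeta_laplace_fract_gt1.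
apply: complexP.
- apply: (@ranalytic_eq0 _ (fun x => complex.Re (E x)) 1) => // [x x0|x x1]; last by rewrite E1.
  have [aZr aZi] := aZ x; have [aP aQ] := ranalytic_laplace_fract t x0.
  (* The real part is expanded into terms built only by addition, real scaling and multiplication by
     the coordinate, the operations under which [ranalytic] is known to be stable. *)
  rewrite (_ : (fun x => _) = (fun x => x * Zr x + ((-1) * Zr x + ((- t) * Zi x +
     ((-1) * (x * 1) + (x * (x * P x) + ((-1) * (x * P x) + ((- t ^+ 2) * P x +
     ((- 2 * t) * (x * Q x) + t * Q x))))))))).
    by repeat (apply: ranalyticD); repeat (apply: ranalyticX || apply: ranalyticZ) => //;
      apply: ranalytic_cst.
  apply/funext => y; rewrite /E /Zr /Zi /P /Q.
  by case: (zeta _) => zr zi; case: (laplace_fract _ _) => p q /=; ring.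
- apply: (@ranalytic_eq0 _ (fun x => complex.Im (E x)) 1) => // [x x0|x x1]; last by rewrite E1.
  have [aZr aZi] := aZ x; have [aP aQ] := ranalytic_laplace_fract t x0.
  rewrite (_ : (fun x => _) = (fun x => x * Zi x + ((-1) * Zi x + (t * Zr x +
     ((- t) + (x * (x * Q x) + ((-1) * (x * Q x) + ((- t ^+ 2) * Q x +
     ((2 * t) * (x * P x) + (- t) * P x))))))))).
    by repeat (apply: ranalyticD); repeat (apply: ranalyticX || apply: ranalyticZ) => //;
      apply: ranalytic_cst.
  apply/funext => y; rewrite /E /Zr /Zi /P /Q.
  by case: (zeta _) => zr zi; case: (laplace_fract _ _) => p q /=; ring.
Qed.

(** For [u < 0] the integer part is 0, so the fractional part is [expR u] itself. At [u = 0] both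
    Heaviside factors equal 1 and the right-hand side is too large. *)
Lemma fract_exp_split u : u != 0 ->
  fract_exp u = heaviside u * fract_exp u + 1 * (heaviside (- u) * expR u).
Proof.
move=> u0; rewrite /heaviside mul1r; have [up|un] := ltP 0 u.
  by rewrite (ltW up) oppr_ge0 leNgt up/= mul1r mul0r addr0.
have un' : u < 0 by rewrite lt_neqAle u0.
by rewrite oppr_ge0 (ltW un') leNgt un'/= mul0r add0r mul1r /fract_exp floor_exp_lt0 ?subr0.
Qed.

Lemma laplace_integ_heaviside_refl s : s < 1 -> laplace_integ (fun u => heaviside (- u) * expR u) s.
Proof.
move=> s1; rewrite (mul_expR_shift (fun u => heaviside (- u))).
by apply: laplace_integ_refl; apply: laplace_integ_heaviside; rewrite opprB subr_gt0.
Qed.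

Lemma laplace_integ_fract_exp s : 0 < s < 1 -> laplace_integ fract_exp s.
Proof.
move=> /andP[s0 s1].
have IH := laplace_integ_heavisideM measurable_fract_exp norm_fract_exp_le1 s0.
apply: (integ_le _ _ (integD IH (laplace_integ_heaviside_refl s1))).
  by apply: measurable_funM; [exact: measurable_fract_exp|exact: measurable_exp].
move=> u; rewrite ger0_norm ?mulr_ge0 ?fract_exp_ge0 ?expR_ge0// -mulrDl ler_wpM2r ?expR_ge0//.
have [->|u0] := eqVneq u 0; last by rewrite {1}fract_exp_split// mul1r.
by rewrite oppr0 /heaviside lexx !mul1r lerDl expR_ge0.
Qed.

(** The half-line [u < 0] contributes 1/(1 - z), which needs [s < 1] and exactly cancels the term
    1/(z - 1) in [laplace_fract]. *)
Lemma laplace_fract_exp s t : t != 0 -> 0 < s < 1 ->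
  laplace fract_exp s t = - (zeta (s +i* t) / (s +i* t)).
Proof.
move=> t0 s01; have /andP[s0 s1] := s01.
have IH := laplace_integ_heavisideM measurable_fract_exp norm_fract_exp_le1 s0.
have IR := laplace_integ_heaviside_refl s1.
have Is := laplace_integ_lin 1 IH IR.
rewrite (@laplace_ae fract_exp (fun u => heaviside u * fract_exp u + 1 * (heaviside (- u) * expR u)) s t [set 0]) //.
- rewrite (laplace_lin _ _ IH IR) (laplace_expR (fun u => heaviside (- u))).
  have s1' : 0 < - (s - 1) by rewrite opprB subr_gt0.
  rewrite (laplace_refl _ (laplace_integ_heaviside s1')) laplace_heaviside// -/(laplace_fract s t).
  have -> : - (s - 1) +i* - t = 1 - (s +i* t) by apply: complexP => /=; ring.
  have z0 : s +i* t != 0 by rewrite eq_complex/= gt_eqF.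
  have z1 : s +i* t - 1 != 0 by rewrite eq_complex/= subr0 (negbTE t0) andbF.
  have z1' : 1 - (s +i* t) != 0 by rewrite -opprB oppr_eq0.
  have K := zeta_laplace_fract t0 s0.
  apply: (mulfI z0); apply: (mulfI z1); apply/eqP; rewrite -subr_eq0 -[X in _ == X]K.
  by apply/eqP; field; rewrite z0 z1'.
- by move=> u /= u0; apply: fract_exp_split; apply/eqP.
- exact: laplace_integ_fract_exp.
Qed.

End zeta.
End laplace.

(** * The step functions [f_k] *)

Section step_functions.
Context {R : realType}.
Implicit Types (s t u x : R) (k m n N : nat).

Lemma floor_truncn x : 0 <= x -> Num.floor x = (Num.truncn x)%:Z.
Proof.
by move=> x0; apply: floor_def; rewrite intrD -!pmulrn natr1; exact: truncn_itv.
Qed.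

(** Both sides have the same natural numbers below them. Applied to [x^-1], this makes
    [fract_diff k x] a function of the integer part of [x^-1] alone. *)
Lemma truncn_div x k : (0 < k)%N -> 0 <= x ->
  Num.truncn (x / k%:R) = (Num.truncn x %/ k)%N.
Proof.
move=> k0 x0; have k0R : 0 < k%:R :> R by rewrite ltr0n.
have H n : (n <= Num.truncn (x / k%:R))%N = (n <= Num.truncn x %/ k)%N.
  rewrite truncn_ge_nat ?divr_ge0// ler_pdivlMr// leq_divRL// -natrM.
  by rewrite truncn_ge_nat.
by apply/eqP; rewrite eqn_leq -H leqnn H leqnn.
Qed.

(** The value of [fract_diff k] at a point where the integer part of [x^-1] is [m]; it is the
    remainder of [m] modulo [k], divided by [k]. *)
Definition modn_ratio k m : R := k%:R^-1 * m%:R - (m %/ k)%:R.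

Lemma modn_ratio0 k : modn_ratio k 0 = 0.
Proof. by rewrite /modn_ratio mulr0 div0n subrr. Qed.

Lemma modn_ratioE k m : (0 < k)%N -> modn_ratio k m = (m %% k)%:R / k%:R.
Proof.
move=> k0; have k0R : k%:R != 0 :> R by rewrite pnatr_eq0 -lt0n.
by rewrite /modn_ratio {1}(divn_eq m k) natrD natrM; field.
Qed.

Lemma modn_ratio_itv k m : (0 < k)%N -> 0 <= modn_ratio k m <= 1.
Proof.
move=> k0; rewrite modn_ratioE// divr_ge0//= ler_pdivrMr ?ltr0n// mul1r ler_nat.
by rewrite ltnW// ltn_mod.
Qed.

Lemma fract_diffE k x : (0 < k)%N -> 0 < x ->
  fract_diff k x = modn_ratio k (Num.truncn x^-1).
Proof.
move=> k0 x0; have k0R : 0 < k%:R :> R by rewrite ltr0n.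
rewrite /fract_diff /modn_ratio !floor_truncn ?invr_ge0 ?mulr_ge0 ?ltW//.
rewrite -!pmulrn; congr (_ - _%:R).
by rewrite invfM mulrC truncn_div// invr_ge0 ltW.
Qed.

Definition fract_diff_exp k u := modn_ratio k (Num.truncn (expR u)).

Lemma fract_diff_expE k u : (0 < k)%N ->
  fract_diff_exp k u = fract_exp (u - ln k%:R) + - k%:R^-1 * fract_exp u.
Proof.
move=> k0; have k0R : 0 < k%:R :> R by rewrite ltr0n.
rewrite /fract_diff_exp /modn_ratio /fract_exp /floor_exp expRD expRN lnK ?posrE// truncn_div ?expR_ge0//.
by field; rewrite gt_eqF.
Qed.

Lemma laplace_fract_diff_exp k s t : (0 < k)%N -> 0 < s < 1 ->
  laplace (fract_diff_exp k) s t = (cpow k%:R (- (s +i* t)) - k%:R^-1) * laplace fract_exp s t.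
Proof.
move=> k0 s01; have If := laplace_integ_fract_exp s01.
have -> : fract_diff_exp k = (fun u => fract_exp (u - ln k%:R) + - k%:R^-1 * fract_exp u).
  by apply/funext => u; exact: fract_diff_expE.
rewrite (laplace_lin _ _ (laplace_integ_shift _ If) If) laplace_shift// -/(cpow _ _) mulrBl; congr (_ + _).
by rewrite rmorphN fmorphV rmorph_nat mulNr.
Qed.

Lemma norm_fract_diff_exp_le1 k u : (0 < k)%N -> `|fract_diff_exp k u| <= 1.
Proof.
move=> k0; have /andP[h0 h1] := modn_ratio_itv (Num.truncn (expR u)) k0.
by rewrite ger0_norm.
Qed.

Lemma heaviside_fract_diff_exp k u : heaviside u * fract_diff_exp k u = fract_diff_exp k u.
Proof.
rewrite /heaviside; have [_|u0] := leP 0 u; first by rewrite mul1r.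
by rewrite /fract_diff_exp truncn_expR_lt0// modn_ratio0 mulr0.
Qed.

Lemma measurable_fract_diff_exp k : (0 < k)%N -> mfun (fract_diff_exp k).
Proof.
move=> k0; rewrite (_ : fract_diff_exp k =
    (fun u => fract_exp (u - ln k%:R) + - k%:R^-1 * fract_exp u)); last first.
  by apply/funext => u; exact: fract_diff_expE.
apply: measurable_funD.
  apply: (measurableT_comp measurable_fract_exp).
  by apply: measurable_funB.
by apply: measurable_funM => //; exact: measurable_fract_exp.
Qed.

(* [f_k (exp (- u))], weighted so that [x = exp (- u)] is an [L^2] isometry. *)
Definition fract_diff_half k u := fract_diff_exp k u * expR (- 2^-1 * u).

(** It contains all jumps of the integer part of [expR u]. The index 0 adds only a default value of
    [ln] and spares [cvg_truncn_expR] a separate case [m = 0]. *)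
Definition ln_naturals : set R := range (fun n : nat => ln n%:R).

Lemma countable_ln_naturals : countable ln_naturals.
Proof.
apply: (@sub_countable _ _ _ [set: nat]); last exact: countableP.
exact: card_image_le.
Qed.

Lemma cvg_truncn_expR u : ~ ln_naturals u ->
  \forall v \near u, Num.truncn (expR v) = Num.truncn (expR u).
Proof.
move=> Au; set m := Num.truncn (expR u).
have /andP[mu um] : m%:R <= expR u < m.+1%:R by rewrite truncn_itv ?expR_ge0.
have mu' : m%:R < expR u.
  rewrite lt_neqAle mu andbT; apply/eqP => E; apply: Au.
  by exists m => //; rewrite E expRK.
have c : expR v @[v --> u] --> expR u by exact: continuous_expR.
near=> v; apply: truncn_def; apply/andP; split.
  by apply: ltW; near: v; exact: (cvgr_gt _ c).
by near: v; exact: (cvgr_lt _ c).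
Unshelve. all: by end_near. Qed.

(** The step function is bounded and vanishes for [u < 0], so the factor [expR (- 2^-1 * u)] alone
    ensures integrability and keeps the bound 1. *)
Lemma fract_diff_half_admissible k : (0 < k)%N -> exists M : R,
  [/\ integ (fract_diff_half k), forall u, `|fract_diff_half k u| <= M &
      forall u, ~ ln_naturals u -> fract_diff_half k v @[v --> u] --> fract_diff_half k u].
Proof.
move=> k0; have i20 : 0 < 2^-1 :> R by rewrite invr_gt0.
have B u : `|fract_diff_half k u| <= heaviside u * expR (- 2^-1 * u).
  rewrite /fract_diff_half -heaviside_fract_diff_exp -mulrA normrM (ger0_norm (heaviside_ge0 u)) ler_wpM2l//.
  by rewrite normrM (ger0_norm (expR_ge0 _)) ler_piMl ?expR_ge0 ?norm_fract_diff_exp_le1.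
exists 1; split.
- apply: (integ_le _ B (integ_exp_halfline i20)).
  by apply: measurable_funM; [exact: measurable_fract_diff_exp|exact: measurable_exp].
- move=> u; apply: (le_trans (B u)); rewrite /heaviside; have [u0|_] := leP 0 u.
    by rewrite mul1r -expR0 ler_expR mulNr oppr_le0 mulr_ge0// ltW.
  by rewrite mul0r.
- move=> u Au; apply: cvgM; last exact: continuous_expRN.
  apply: cvg_near_cst; apply: filterS (cvg_truncn_expR Au) => v vu.
  by rewrite /fract_diff_exp vu.
Qed.

(** The difference of the two booleans is the indicator of [m = n.+1], so at most one term survives;
    [c 0 = 0] accounts for [m = 0]. *)
Lemma step_sum (c : nat -> R) m N : c 0%N = 0 ->
  \sum_(0 <= n < N) c n.+1 * ((n < m)%N%:R - (n.+1 < m)%N%:R) =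
  if (m <= N)%N then c m else 0.
Proof.
move=> c0; elim: N => [|N IH].
  by rewrite big_geq// leqn0; case: eqP => // ->.
rewrite big_nat_recr//= IH; case: (ltngtP m N.+1) => mN.
- by rewrite -ltnS mN subrr mulr0 addr0.
- by rewrite leqNgt (ltnW mN)/= subrr mulr0 addr0.
- by rewrite mN ltnn subr0 mulr1 add0r.
Qed.

(** The integral depends on [mx] and [r] only through the masses of the sets where [n < mx x]:
    truncating at [N] gives a finite combination of these, dominated by [r]. Two pairs with equal
    masses thus have equal integrals. *)
Lemma step_integral (c : nat -> R) (mx : R -> nat) (r : R -> R) :
  c 0%N = 0 -> (forall n, 0 <= c n <= 1) -> integ r -> (forall x, 0 <= r x) ->
  (forall n, integ (fun x => (n < mx x)%N%:R * r x)) ->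
  integ (fun x => c (mx x) * r x) /\
  (fun N => \sum_(0 <= n < N) c n.+1 * (\intR (fun x => (n < mx x)%N%:R * r x) -
     \intR (fun x => (n.+1 < mx x)%N%:R * r x))) @ \oo -->
  \intR (fun x => c (mx x) * r x).
Proof.
move=> c0 c01 Ir r0 IA.
pose S N x := (if (mx x <= N)%N then c (mx x) else 0) * r x.
have SE N : S N = (fun x => \sum_(0 <= n < N) c n.+1 *
    ((n < mx x)%N%:R * r x - (n.+1 < mx x)%N%:R * r x)).
  apply/funext => x; rewrite /S -step_sum// mulr_suml; apply: eq_bigr => n _.
  by rewrite -mulrA mulrBl.
have IS N : integ (S N) /\ \intR (S N) = \sum_(0 <= n < N) c n.+1 *
    (\intR (fun x => (n < mx x)%N%:R * r x) - \intR (fun x => (n.+1 < mx x)%N%:R * r x)).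
  rewrite SE; elim: N => [|N [IN EN]].
    under eq_fun do rewrite big_geq//.
    rewrite big_geq//; split; first exact: integrable0.
    by rewrite Rintegral_cst// mul0r.
  under eq_fun do rewrite big_nat_recr//=.
  have Id := integB (IA N) (IA N.+1).
  rewrite big_nat_recr//=; split; first exact: integD (integ_scale _ Id).
  rewrite (RintegralD measurableT IN (integ_scale _ Id)) EN; congr (_ + _).
  by rewrite (RintegralZl _ measurableT Id) (RintegralB measurableT (IA N) (IA N.+1)).
have Sc x : S ^~ x @ \oo --> c (mx x) * r x.
  by apply: cvg_near_cst; exists (mx x) => // N /= xN; rewrite /S xN.
(* Measurability of [mx] is not among the hypotheses; it is replaced by the pointwise limit of the
   integrable functions [S N]. *)
have mS : mfun (fun x => c (mx x) * r x).
  apply/measurable_EFinP; apply: (emeasurable_fun_cvg (fun N => EFin \o S N)).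
    by move=> N; exact: measurable_int (IS N).1.
  by move=> x _; apply: cvg_EFin; [exact: nearW|exact: Sc].
have [||||If L] := @intR_dominated _ S (fun x => c (mx x) * r x) r _ _ _ Ir.
- by move=> N; exact: integ_mfun (IS N).1.
- exact: mS.
- by apply: aeW => x; exact: Sc.
- move=> N x; rewrite normrM (ger0_norm (r0 x)) ler_piMl//.
  have /andP[h0 h1] := c01 (mx x).
  by case: ifP => _; rewrite ?normr0 ?ger0_norm.
split=> //; move: L.
by rewrite (_ : (fun N => \intR (S N)) = (fun N => \sum_(0 <= n < N) c n.+1 *
    (\intR (fun x => (n < mx x)%N%:R * r x) - \intR (fun x => (n.+1 < mx x)%N%:R * r x))))//;
  apply/funext => N; rewrite (IS N).2.
Qed.

Lemma step_expR n :
  integ (fun u => (n < Num.truncn (expR u))%N%:R * (heaviside u * expR (- 1 * u))) /\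
  \intR (fun u => (n < Num.truncn (expR u))%N%:R * (heaviside u * expR (- 1 * u))) =
  n.+1%:R^-1 :> R.
Proof.
have I1 := integ_exp_halfline (@ltr01 R).
pose a := ln n.+1%:R : R.
have E : (fun u => (n < Num.truncn (expR u))%N%:R * (heaviside u * expR (- 1 * u))) =
    (fun u => n.+1%:R^-1 * ((fun v => heaviside v * expR (- 1 * v)) (u + (- a)))) :> (R -> R).
  apply/funext => u /=; rewrite mulrDr expRD !mulN1r opprK /a lnK ?posrE//.
  have -> : (n < Num.truncn (expR u))%N = (0 <= u - ln n.+1%:R).
    by rewrite truncn_gt_nat subr_ge0 -[RHS]ler_expR lnK ?posrE.
  rewrite /heaviside; case: (leP 0 (u - _)) => ua; last by rewrite !mul0r mulr0.
  have -> : 0 <= u.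
    have l0 : 0 <= ln n.+1%:R :> R by rewrite ln_ge0// ler1n.
    by lra.
  by rewrite !mul1r; field; rewrite gt_eqF.
rewrite E; have Is := integ_shift (- a) I1; split; first exact: integ_scale.
rewrite (RintegralZl _ measurableT Is) -(intR_shift (- a) I1).
have := @intR_expcos R 1 0 ltr01.
under eq_Rintegral do rewrite mul0r cos0 mulr1.
by move=> ->; rewrite expr0n addr0 expr1n divr1 mulr1.
Qed.

Let J : set R := `]0, 1]%classic.

Let measurable_J : measurable (J : set (measurableTypeR R)).
Proof. exact: measurable_itv. Qed.

Lemma integ_indic (A : set (measurableTypeR R)) : measurable A ->
  (lebR A < +oo)%E -> integ (\1_A : R -> R).
Proof.
move=> mA Afin; apply/integrableP; split; first exact/measurable_EFinP/measurable_indic.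
rewrite [ltLHS](_ : _ = lebR A)// -[in RHS](setIT A) -integral_indic//.
by apply: eq_integral => t _ /=; rewrite ger0_norm.
Qed.

Lemma intR_indic (a : R) : 0 <= a ->
  integ (\1_(`]0, a]%classic : set R)) /\ \intR (\1_(`]0, a]%classic : set R)) = a.
Proof.
move=> a0; have m : lebR (`]0, a]%classic : set R) = a%:E.
  rewrite lebesgue_measure_itv/= lte_fin; case: ltgtP a0 => // [a0 _|<- _//].
  by rewrite sube0.
split.
  by apply: integ_indic; [exact: measurable_itv|rewrite m ltry].
by rewrite /Rintegral integral_indic// setIT; exact: (congr1 fine m).
Qed.

Lemma step_inv n :
  integ (fun x => (n < Num.truncn x^-1)%N%:R * \1_J x) /\
  \intR (fun x => (n < Num.truncn x^-1)%N%:R * \1_J x) = n.+1%:R^-1 :> R.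
Proof.
have n0 : 0 < n.+1%:R :> R by rewrite ltr0n.
have i0 : 0 <= n.+1%:R^-1 :> R by rewrite invr_ge0.
rewrite (_ : (fun x => _) = \1_(`]0, n.+1%:R^-1]%classic : set R)); first exact: intR_indic.
apply/funext => x; rewrite !indicE !mem_setE !in_itv/=.
have [x0|x0] := ltP 0 x; last by rewrite mulr0.
rewrite truncn_gt_nat /= -natrM mulnb; congr ((nat_of_bool _)%:R).
have -> : (n.+1%:R <= x^-1) = (x <= n.+1%:R^-1).
  by rewrite -[in RHS]lef_pV2 ?posrE ?invr_gt0// invrK.
apply: andb_idr => /le_trans; apply; rewrite invf_le1//.
by rewrite ler1n.
Qed.

(** The sets where the integer exceeds [n] have mass [n.+1%:R^-1] both for dx on [J] and for
    exp(-u)du on the half-line, so the two integrals are limits of one sequence. *)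
Lemma step_change (c : nat -> R) : c 0%N = 0 -> (forall n, 0 <= c n <= 1) ->
  integ (fun x => c (Num.truncn x^-1) * \1_J x) /\
  \intR (fun x => c (Num.truncn x^-1) * \1_J x) =
  \intR (fun u => c (Num.truncn (expR u)) * (heaviside u * expR (- 1 * u))).
Proof.
move=> c0 c01.
have [IJ _] := intR_indic (@ler01 R).
have [Ix Lx] := step_integral c0 c01 IJ (fun x => ler0n _ _) (fun n => (step_inv n).1).
have r0 u : 0 <= heaviside u * expR (- 1 * u) :> R by rewrite mulr_ge0// expR_ge0.
have [Iu Lu] := step_integral c0 c01 (integ_exp_halfline (@ltr01 R)) r0
  (fun n => (step_expR n).1).
split=> //; apply: (cvg_unique (@Rhausdorff R) Lx).
move: Lu; rewrite (_ : (fun N => _) = (fun N => \sum_(0 <= n < N) c n.+1 *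
  (\intR (fun x => (n < Num.truncn x^-1)%N%:R * \1_J x) -
   \intR (fun x => (n.+1 < Num.truncn x^-1)%N%:R * \1_J x))))//.
apply/funext => N; apply: eq_bigr => n _.
by rewrite !(step_expR _).2 !(step_inv _).2.
Qed.

Lemma fract_diff_integral j k : (0 < j)%N -> (0 < k)%N ->
  (@lebesgue_measure R).-integrable `]0, 1]
    (fun x : R => (fract_diff j x * fract_diff k x)%:E) /\
  \int[@lebesgue_measure R]_(x in `]0%R, 1%R]) (fract_diff j x * fract_diff k x) =
  \intR (fun u => fract_diff_half j u * fract_diff_half k u).
Proof.
move=> j0 k0.
have [] := @step_change (fun m => modn_ratio j m * modn_ratio k m).
- by rewrite modn_ratio0 mul0r.
- move=> m; have /andP[a0 a1] := modn_ratio_itv m j0; have /andP[b0 b1] := modn_ratio_itv m k0.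
  by rewrite mulr_ge0//= mulr_ile1.
rewrite (_ : (fun x => _) = ((fun x => fract_diff j x * fract_diff k x) \_ J)); last first.
  apply/funext => x; rewrite patchE indicE; case: ifPn => [|_]; last by rewrite mulr0.
  rewrite /J mem_setE in_itv/= => /andP[x0 _].
  by rewrite mulr1 !fract_diffE.
move=> IJ EJ; split.
  apply/(@integrable_mkcond _ _ _ (@lebesgue_measure R) _
    (fun x => (fract_diff j x * fract_diff k x)%:E) measurable_J).
  by rewrite (restrict_EFin (fun x => fract_diff j x * fract_diff k x)).
rewrite Rintegral_mkcond EJ; congr (\intR _); apply/funext => u.
rewrite /fract_diff_half -[fract_diff_exp j u in RHS]heaviside_fract_diff_exp /fract_diff_exp.
have -> : expR (- 1 * u) = expR (- 2^-1 * u) * expR (- 2^-1 * u).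
  by rewrite -expRD; congr expR; field.
ring.
Qed.

End step_functions.

(** * From the transforms of the step functions to the zeta integrand *)

Section main.
Context {R : realType}.
Variables (zeta : R[i] -> R[i]) (hzeta : is_riemann_zeta zeta).

Lemma sqr_normc (z : R[i]) : `|z| ^+ 2 = z * conjc z.
Proof.
case: z => a b; rewrite normc_def/= -rmorphXn/= sqr_sqrtr ?addr_ge0 ?sqr_ge0//.
by apply: complexP => /=; ring.
Qed.

(** For s = 1/2 + it the exponent 1/2 - it is 1 - s, which is special to the critical line. *)
Lemma cpow_half (k : nat) (t : R) : (0 < k)%N ->
  cpow k%:R (2^-1 -i* t) = k%:R * cpow k%:R (- (2^-1 +i* t)).
Proof.
move=> k0; have k0R : 0 < k%:R :> R by rewrite ltr0n.
have E : expR (2^-1 * ln k%:R) = k%:R * expR (- 2^-1 * ln k%:R) :> R.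
  by rewrite -{2}(lnK k0R) -expRD; congr expR; field.
rewrite /cpow /expC /= !mulr0 !subr0 !add0r E -(rmorph_nat (real_complex R)) rmorphM.
by rewrite -mulrA.
Qed.

Lemma conjc_cpow (k : nat) (s t : R) :
  cpow k%:R (s +i* t) = conjc (cpow k%:R (s -i* t)).
Proof.
rewrite /cpow /expC /= !mulr0 !subr0 !add0r mulNr cosN sinN.
by apply: complexP => /=; ring.
Qed.

(** Multiplying by [j] and [k] turns each factor [k^-s - 1/k] into [k^(1-s) - 1]. Conjugation
    restores the exponent 1/2 + it for [k], the two minus signs cancel, and the denominators combine
    to [1/4 + t^2]. *)
Lemma zeta_integrandE (j k : nat) (t : R) : (0 < j)%N -> (0 < k)%N -> t != 0 ->
  zeta_integrand zeta j k t = (j%:R * k%:R) *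
   (laplace (fract_diff_exp j) 2^-1 t * conjc (laplace (fract_diff_exp k) 2^-1 t)).
Proof.
move=> j0 k0 t0; have h01 : 0 < (2^-1 : R) < 1 by rewrite invr_gt0 ltr0n/= invf_lt1// ltr1n.
rewrite !laplace_fract_diff_exp// (laplace_fract_exp hzeta t0 h01) /zeta_integrand.
rewrite (conjc_cpow k) !cpow_half// sqr_normc.
set X := cpow j%:R _; set Y := cpow k%:R _; set z := zeta _; set w := 2^-1 +i* t.
have wE : (4^-1 + t ^+ 2)%:C = w * conjc w.
  by apply: complexP => /=; field.
have w0 : w != 0 by rewrite eq_complex/= (negbTE t0) andbF.
have w0' : conjc w != 0 by rewrite conjc_eq0.
have cM (a b : R[i]) : conjc (a * b) = conjc a * conjc b by exact: rmorphM.
have cB (a b : R[i]) : conjc (a - b) = conjc a - conjc b by exact: rmorphB.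
have cN (a : R[i]) : conjc (- a) = - conjc a by exact: rmorphN.
rewrite wE; clearbody X Y z w; rewrite !cM cN cM cB !conjc_inv !conjc_nat.
have jC : j%:R != 0 :> R[i] by rewrite pnatr_eq0 -lt0n.
have kC : k%:R != 0 :> R[i] by rewrite pnatr_eq0 -lt0n.
by field; rewrite w0 w0' jC kC.
Qed.

Lemma integ_modify (F G : R -> R) : integ F -> (forall t, t != 0 -> G t = F t) ->
  integ G /\ \intR G = \intR F.
Proof.
move=> IF GF.
have E : G = (fun t => F t + (G 0 - F 0) * \1_[set 0] t).
  apply/funext => t; rewrite indicE; have [->|t0] := eqVneq t 0.
    by rewrite mem_set// mulr1 addrC subrK.
  by rewrite memNset ?mulr0 ?addr0 ?GF// => /eqP; apply/negP.
have I1 : integ (\1_[set (0 : R)]).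
  by apply: integ_indic; [exact: measurable_set1|rewrite lebesgue_measure_set1 ltry].
have IG : integ G by rewrite E; apply: integD => //; exact: integ_scale.
split=> //; apply: intR_ae_eq.
- exact: integ_mfun IG.
- exact: integ_mfun IF.
- by apply: (@ae_notin_countable _ [set 0]); [exact: countable1|
    move=> t /eqP; exact: GF].
Qed.

Lemma fract_diff_parseval (j k : nat) (hj : (0 < j)%N) (hk0 : (0 < k)%N) :
  [/\ (@lebesgue_measure R).-integrable `]0, 1]
        (fun x : R => (fract_diff j x * fract_diff k x)%:E),
      Cintegrable (@lebesgue_measure R) [set: R] (zeta_integrand zeta j k)
    & (\int[@lebesgue_measure R]_(x in `]0%R, 1%R])
         (fract_diff j x * fract_diff k x))%:C
      = (2 * pi * j%:R * k%:R)^-1%:C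
        * Cintegral (@lebesgue_measure R) [set: R] (zeta_integrand zeta j k) ].
Proof.
have [If Ef] := @fract_diff_integral R j k hj hk0.
have [IF EF IG EG] := @parseval R ln_naturals countable_ln_naturals _ _
  (fract_diff_half_admissible hj) (fract_diff_half_admissible hk0).
have zE t : t != 0 -> zeta_integrand zeta j k t = (j%:R * k%:R)%:C *
  ((Fcos (fract_diff_half j) t * Fcos (fract_diff_half k) t +
    Fsin (fract_diff_half j) t * Fsin (fract_diff_half k) t) +i*
   (Fcos (fract_diff_half j) t * Fsin (fract_diff_half k) t -
    Fsin (fract_diff_half j) t * Fcos (fract_diff_half k) t)).
  move=> t0; rewrite zeta_integrandE// rmorphM !rmorph_nat; congr (_ * _).
  by rewrite /laplace -/(fract_diff_half j) -/(fract_diff_half k); apply: complexP => /=; ring.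
have zRe t : t != 0 -> complex.Re (zeta_integrand zeta j k t) = j%:R * k%:R *
    (Fcos (fract_diff_half j) t * Fcos (fract_diff_half k) t +
    Fsin (fract_diff_half j) t * Fsin (fract_diff_half k) t).
  by move=> /zE -> /=; rewrite mul0r subr0.
have zIm t : t != 0 -> complex.Im (zeta_integrand zeta j k t) = j%:R * k%:R *
    (Fcos (fract_diff_half j) t * Fsin (fract_diff_half k) t -
    Fsin (fract_diff_half j) t * Fcos (fract_diff_half k) t).
  by move=> /zE -> /=; rewrite mul0r addr0.
have [IRe ERe] := integ_modify (integ_scale (j%:R * k%:R) IF) zRe.
have [IIm EIm] := integ_modify (integ_scale (j%:R * k%:R) IG) zIm.
split; [exact: If|by split; [exact: IRe|exact: IIm]|].
rewrite Ef /Cintegral ERe EIm (RintegralZl _ measurableT IF) (RintegralZl _ measurableT IG).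
(* [EG] makes the imaginary part 0; in the real part the constant from [EF] and the factor
   [j%:R * k%:R] cancel the prefactor. *)
rewrite EF EG; apply: complexP => /=; last by rewrite !mulr0 mul0r addr0.
have j0 : j%:R != 0 :> R by rewrite pnatr_eq0 -lt0n.
have k0 : k%:R != 0 :> R by rewrite pnatr_eq0 -lt0n.
have pi0 : pi != 0 :> R by rewrite gt_eqF ?pi_gt0.
rewrite mul0r subr0 (_ : j%:R * k%:R * (2 * pi * _) = 2 * pi * j%:R * k%:R *
  \intR (fun u => fract_diff_half j u * fract_diff_half k u)); last by ring.
by rewrite mulKf// !mulf_neq0// pnatr_eq0.
Qed.

End main.

(* The two integrability clauses say that the integrals in the identity exist
   in the Lebesgue sense ([Rintegral] being a total function). *)
Theorem theorem16 (R : realType) (zeta : R[i] -> R[i])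
    (hzeta : is_riemann_zeta zeta) (j k : nat)
    (hj : (2 <= j)%N) (hk : (2 <= k)%N) :
  [/\ (@lebesgue_measure R).-integrable `]0, 1]
        (fun x : R => (fract_diff j x * fract_diff k x)%:E),
      Cintegrable (@lebesgue_measure R) [set: R] (zeta_integrand zeta j k)
    & (\int[@lebesgue_measure R]_(x in `]0%R, 1%R])
         (fract_diff j x * fract_diff k x))%:C
      = (2 * pi * j%:R * k%:R)^-1%:C
        * Cintegral (@lebesgue_measure R) [set: R] (zeta_integrand zeta j k) ].
Proof. exact: (fract_diff_parseval hzeta (ltnW hj) (ltnW hk)). Qed.
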